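(* Let $p>1$ and $l\ge 0$ be constants and let $q$ satisfy $1/p+1/q=1$. Let $\tau$ be an $(\mathcal F_t)_{t\ge 0}$-stopping time and let $\xi$ be a non-negative random variable. Let $a(t)$ and $x(t)$ be non-negative $(\mathcal F_t)_{t\ge0}$-progressively measurable processes. Assume that $a(t)>\epsilon$ for some constant $\epsilon>0$, and put $A(t):=\int_0^t a(s)\,ds$. Assume that there is a constant $\theta\ge 0$ such that \[ \mathbb E\Big[e^{\frac{q}{2}(2l-\theta)^+A(\tau)}\Big]<\infty, \] $\xi$ is $\mathcal F_\tau$-measurable with $\mathbb E\big[e^{\frac p2\theta A(\tau)}|\xi|^p\big]<\infty$, and $x$ is a càdlàg adapted process with \[ \mathbb E\bigg[\bigg(\int_0^\tau a(t)\,e^{\frac{\theta}{2}A(t)}|x(t)|\,dt\bigg)^p\bigg]<\infty . \] If, for every $t\ge 0$, \[ x(t)\le \mathbb E\Big[\xi+l\int_{t\wedge\tau}^{\tau}a(s)x(s)\,ds\,\Big|\,\mathcal F_t\Big]\quad \mathbb P\text{-a.s.}, \] then for every $t\ge0$, $\mathbb P$-a.s., \[ x(t)\le \mathbb E\Big[\xi\, e^{l\int_{t\wedge\tau}^{\tau}a(s)\,ds}\,\Big|\,\mathcal F_t\Big]. \]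
   Context: $(\Omega,\mathcal F,\mathbb P)$ is a complete probability space carrying a $d$-dimensional Brownian motion $B=(B_t)_{t\ge0}$, and $(\mathcal F_t)_{t\ge0}$ is the right-continuous completion (augmented by $\mathbb P$-null sets) of the natural filtration $\sigma\{B_s,s\le t\}$ of $B$. For $m\in\mathbb R$, $m^+:=\max\{m,0\}$, and $m\wedge n:=\min\{m,n\}$. *)

(* Defs.v *)
From HB Require Import structures.
From mathcomp Require Import all_boot all_order all_algebra.
From mathcomp Require Import all_classical all_reals all_analysis.
From mathcomp Require Import measurable_realfun normal_distribution.
Set Implicit Arguments. Unset Strict Implicit. Unset Printing Implicit Defensive.
Import Order.TTheory GRing.Theory Num.Theory.
Import numFieldNormedType.Exports.
Local Open Scope classical_set_scope.
Local Open Scope ring_scope.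

Section defs.
Context {d : measure_display} {T : measurableType d} {R : realType}.
Variable P : probability T R.

Definition meas_wrt (G : set (set T)) (f : T -> R) :=
  forall B : set R, measurable B -> G (f @^-1` B).
Definition meas_wrtE (G : set (set T)) (f : T -> \bar R) :=
  forall B : set (\bar R), measurable B -> G (f @^-1` B).

Definition complete_prob :=
  forall A N : set T, measurable N -> P N = 0%E -> A `<=` N -> measurable A.

Definition indep_family (I : finType) (X : I -> T -> R) :=
  forall A : I -> set R, (forall i, measurable (A i)) ->
    P (\bigcap_(i in [set: I]) (X i @^-1` A i)) =
    (\prod_(i : I) P (X i @^-1` A i))%E.

Definition brownian (dim : nat) (B : 'I_dim -> R -> T -> R) :=
  [/\ (forall i t, measurable_fun setT (B i t)),
      (forall i w, B i 0 w = 0),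
      (forall i w, {within [set t | 0 <= t], continuous (fun t => B i t w)}) &
      (forall (n : nat) (t : 'I_n.+1 -> R), t ord0 = 0 ->
         (forall k : 'I_n, t (widen_ord (leqnSn n) k) < t (lift ord0 k)) ->
         let incr := fun (ik : 'I_dim * 'I_n) (w : T) =>
           B ik.1 (t (lift ord0 ik.2)) w - B ik.1 (t (widen_ord (leqnSn n) ik.2)) w in
         indep_family incr /\
         forall (ik : 'I_dim * 'I_n) (A : set R), measurable A ->
           P (incr ik @^-1` A) =
           normal_prob 0 (Num.sqrt (t (lift ord0 ik.2) - t (widen_ord (leqnSn n) ik.2))) A)].

Definition nat_filtration dim (B : 'I_dim -> R -> T -> R) (t : R) : set (set T) :=
  <<s [set E | exists i s (A : set R),
        [/\ 0 <= s <= t, measurable A & E = B i s @^-1` A]] >>.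

Definition null_sets : set (set T) := [set N | measurable N /\ P N = 0%E].

Definition brownian_filtration dim (B : 'I_dim -> R -> T -> R) (t : R) : set (set T) :=
  [set A | forall u, t < u -> (<<s nat_filtration B u `|` null_sets >>) A].

Definition filtration_infty (F : R -> set (set T)) : set (set T) :=
  <<s [set A | exists t, 0 <= t /\ F t A] >>.

Definition stopping_time (F : R -> set (set T)) (tau : T -> \bar R) :=
  (forall w, (0 <= tau w)%E) /\
  forall t, 0 <= t -> F t [set w | (tau w <= t%:E)%E].

Definition stopped_sigma (F : R -> set (set T)) (tau : T -> \bar R) : set (set T) :=
  [set A | filtration_infty F A /\
    forall t, 0 <= t -> F t (A `&` [set w | (tau w <= t%:E)%E])].

Definition progressive (F : R -> set (set T)) (x : R -> T -> R) :=
  forall t, 0 <= t ->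
    let D := [set z : R * T | 0 <= z.1 <= t] in
    forall Bs : set R, measurable Bs ->
      (<<s D, [set E | exists (I : set R) (A : set T),
                 [/\ measurable I, I `<=` [set s | 0 <= s <= t], F t A & E = I `*` A]] >>)
        (D `&` [set z | Bs (x z.1 z.2)]).

Definition adapted (F : R -> set (set T)) (x : R -> T -> R) :=
  forall t, 0 <= t -> meas_wrt (F t) (x t).

Definition cadlag (x : R -> T -> R) :=
  forall w t, 0 <= t ->
    (fun s => x s w) @ t^'+ --> x t w /\
    (0 < t -> exists l : R, (fun s => x s w) @ t^'- --> l).

Definition is_condexp (G : set (set T)) (X Y : T -> \bar R) :=
  [/\ meas_wrtE G Y, (forall w, (0 <= Y w)%E) &
      forall A, G A -> (\int[P]_(w in A) Y w = \int[P]_(w in A) X w)%E].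

End defs.

(* Main.v *)
(** Fix [t] and an event [G] of [F t], let [al] be [a] restricted to the stochastic
    interval [[t, tau]] and to [G], and let [E s = exp (l * int_{r <= s} al r)], which is
    adapted. Young's inequality and the two moment conditions make
    [L = E[int al E x]] finite. Testing the hypothesis at each time [s] against the
    [F s]-measurable weight [al s * E s] and integrating in [s] gives, by Tonelli,
    [L <= E[xi * int al E] + N] with [N = E[int al x k]] and
    [k r = l * int_{s <= r} al s * E s]. Since [1 + k r <= E r], also
    [E[int al x] + N <= L], and cancelling the finite [N] leaves
    [E[int al x] <= E[xi * int al E]]. Inserting this into the hypothesis at time [t]
    and using [1 + l * int al E <= exp (l * int al)] yields the integral of the
    conclusion over [G]. *)

Require Import Defs.
From HB Require Import structures.
From mathcomp Require Import all_boot all_order all_algebra.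
From mathcomp Require Import all_classical all_reals all_analysis.
From mathcomp Require Import measurable_realfun normal_distribution.
From mathcomp Require Import lra.
Import Order.TTheory GRing.Theory Num.Theory.
Import numFieldNormedType.Exports.
Local Open Scope classical_set_scope.
Local Open Scope ring_scope.

Set Implicit Arguments. Unset Strict Implicit. Unset Printing Implicit Defensive.

(** * The exponential of an indefinite integral *)

(** The bound on [x] holds only under conditional expectations, off a null set that varies with the
    time, so it cannot be iterated along a single path. It is therefore integrated over the sample
    space at a fixed time first, and over time afterwards. The weight [E] solves the equation dual
    to the hypothesis: exchanging the two time integrals moves the future integral of [al * x] onto
    the past integral [k] of the weight, and [1 + k = E] along a path on which [al] is integrable.
    Since [A(tau)] may be infinite, integrals stay in the extended reals and the proof relies on
    [1 + k <= E], which survives that case. The moment conditions fit together because [l] is at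
    most [(2l - theta)^+ / 2 + theta / 2]: the first part is charged to the exponential moment of
    [A(tau)], the second is the weight already present in the moment of [x]. *)

Lemma measurable_expeR (R : realType) : measurable_fun [set: \bar R] expeR.
Proof.
(* [er_map] keeps [-oo] fixed, whereas [expeR -oo] is 0. *)
have -> : @expeR R = (fun x => if x == -oo%E then 0%E else er_map expR x).
  by apply/funext => -[].
apply: measurable_fun_ifT => //=; first exact: measurable_fun_eqe.
exact: (@measurable_er_map _ (measurableTypeR R) R expR (@measurable_expR R)).
Qed.

(** The chain rule for the absolutely continuous [c] would give the exact value
    [expR (c s) - expR (c a)]. The factor [expR delta] is the price of an argument without
    differentiation; [exp_integral_le] lets [delta] tend to 0. *)
Lemma exp_integral_itv_le (R : realType) (f : R -> R) (delta : R) :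
  0 < delta -> (forall s, 0 <= f s) ->
  lebesgue_measure.-integrable setT (EFin \o f) ->
  let c := fun s => \int[lebesgue_measure]_(r in `]-oo, s]) f r in
  forall a s, a <= s ->
  (\int[lebesgue_measure]_(r in `]a, s]) ((f r)%:E * (expR (c r))%:E) <=
   (expR delta * (expR (c s) - expR (c a)))%:E)%E.
Proof.
move=> d0 f0 intf c.
have intfS (D : set R) : measurable D -> lebesgue_measure.-integrable D (EFin \o f).
  by move=> mD; apply: integrableS intf.
have mf : measurable_fun setT f by apply/measurable_EFinP; exact: measurable_int intf.
have cB a s : a <= s -> c s - c a = \int[lebesgue_measure]_(r in `]a, s]) f r.
  by move=> as_; rewrite /c Rintegral_itvB//; exact: intfS.
have cnd : nondecreasing_fun c.
  by move=> a s as_; rewrite -subr_ge0 cB//; apply: Rintegral_ge0.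
have mc : measurable_fun setT c by exact: nondecreasing_measurable.
clearbody c.
have mfec (D : set R) : measurable D ->
    measurable_fun D (fun r => ((f r)%:E * (expR (c r))%:E)%E).
  move=> mD; apply: measurable_funTS; apply/measurable_EFinP.
  by apply: measurable_funM => //; apply: measurableT_comp.
(* For [u = c s - c a <= delta]: [u <= exp u - 1] and [exp (c s) <= exp delta * exp (c a)].
   Longer intervals are cut, by the intermediate value theorem applied to [c], into
   pieces on which [c] increases by at most [delta]. *)
have step a s : a <= s -> c s - c a <= delta ->
    (\int[lebesgue_measure]_(r in `]a, s]) ((f r)%:E * (expR (c r))%:E) <=
    (expR delta * (expR (c s) - expR (c a)))%:E)%E.
  move=> as_ csa.
  apply: (@le_trans _ _ (\int[lebesgue_measure]_(r in `]a, s])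
      ((f r)%:E * (expR (c s))%:E)))%E.
    apply: ge0_le_integral => //.
    - by move=> r _; rewrite lee_fin mulr_ge0// expR_ge0.
    - exact: mfec.
    - apply: measurable_funTS; apply/measurable_EFinP.
      exact: measurable_funM.
    - move=> r /=; rewrite in_itv/= => /andP[ar rs].
      by rewrite lee_fin ler_wpM2l// ler_expR cnd.
  rewrite integralZr//; last exact: intfS.
  have -> : (\int[lebesgue_measure]_(r in `]a, s]) (f r)%:E = (c s - c a)%:E)%E.
    by rewrite cB// fineK//; apply: integrable_fin_num => //; exact: intfS.
  rewrite -EFinM lee_fin.
  have -> : expR (c s) - expR (c a) = expR (c a) * (expR (c s - c a) - 1).
    by rewrite mulrBr mulr1 -expRD subrKC.
  have h1 : c s - c a <= expR (c s - c a) - 1.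
    by have := expR_ge1Dx (c s - c a); lra.
  have h2 : expR (c s) <= expR delta * expR (c a).
    by rewrite -expRD ler_expR; lra.
  have h3 := expR_gt0 (c s).
  have h4 : 0 <= c s - c a by rewrite subr_ge0 cnd.
  rewrite mulrA mulrC; apply: ler_pM => //; exact: expR_ge0.
have split3 a b s : a <= b -> b <= s ->
    (\int[lebesgue_measure]_(r in `]a, s]) ((f r)%:E * (expR (c r))%:E) =
     \int[lebesgue_measure]_(r in `]a, b]) ((f r)%:E * (expR (c r))%:E) +
     \int[lebesgue_measure]_(r in `]b, s]) ((f r)%:E * (expR (c r))%:E))%E.
  move=> ab bs.
  rewrite (@itv_bndbnd_setU _ _ _ (BRight b)) ?bnd_simp//.
  rewrite ge0_integral_setU//=.
  - by rewrite -itv_bndbnd_setU ?bnd_simp//; exact: mfec.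
  - by move=> r _; rewrite lee_fin mulr_ge0// expR_ge0.
  - apply/disj_set2P; rewrite -subset0 => z/=; rewrite !in_itv/= => -[/andP[_ zb]].
    by rewrite ltNge zb.
suff H (n : nat) a s : a <= s -> c s - c a <= n%:R * delta ->
    (\int[lebesgue_measure]_(r in `]a, s]) ((f r)%:E * (expR (c r))%:E) <=
    (expR delta * (expR (c s) - expR (c a)))%:E)%E.
  move=> a s as_.
  have csa0 : 0 <= (c s - c a) / delta by rewrite divr_ge0 ?subr_ge0 ?cnd// ltW.
  by have := archi_boundP csa0; rewrite ltr_pdivrMr// => /ltW; exact: H.
elim: n a s => [|n ih] a s as_ csa.
  by apply: step => //; rewrite (le_trans csa)// mul0r ltW.
have [csa1|csa1] := leP (c s - c a) delta; first exact: step.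
have cc : {within `[a, s], continuous c}.
  have cE : {in `[a, s], (fun x => c a + parameterized_integral lebesgue_measure a x f) =1 c}.
    move=> x; rewrite in_itv/= => /andP[ax _].
    rewrite /parameterized_integral -Rintegral_itv_obnd_cbnd//.
      by rewrite -cB// subrKC.
    exact: intfS.
  apply: (@subspace_eq_continuous _ _ _
    (fun x => c a + parameterized_integral lebesgue_measure a x f)).
    by move=> x /set_mem xas; apply: cE.
  move=> x; apply: cvgD; first exact: cvg_cst.
  by apply: parameterized_integral_continuous => //; exact: intfS.
(* The cut is made from the right: [c] grows by exactly [delta] on []b, s]], which leaves at most
   [n * delta] on []a, b]] for the induction. *)
have [//||b] := @IVT R c a s (c s - delta) _ cc.
  rewrite min_l ?max_r ?cnd//; lra.
rewrite in_itv/= => /andP[ab bs] cb.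
rewrite (split3 a b s)//.
apply: (le_trans (leeD (ih a b ab _) (step b s bs _))).
- by move: csa; rewrite -natr1; lra.
- lra.
- by rewrite -EFinD lee_fin; lra.
Qed.

(** If [f] is not integrable the right side is [+oo]. Otherwise the running integral [c] lies
    between 0 and the total [I], so the bounds on bounded intervals are uniform and pass to the
    whole line. *)
Lemma exp_integral_le (R : realType) (f : R -> R) :
  measurable_fun setT f -> (forall s, 0 <= f s) ->
  (1 + \int[lebesgue_measure]_s ((f s)%:E *
       expeR (\int[lebesgue_measure]_(r in `]-oo, s]) (f r)%:E)) <=
   expeR (\int[lebesgue_measure]_s (f s)%:E))%E.
Proof.
move=> mf f0.
have f0' (D : set R) : (0 <= \int[lebesgue_measure]_(s in D) (f s)%:E)%E.
  by apply: integral_ge0 => s _; rewrite lee_fin.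
have [->|] := eqVneq (\int[lebesgue_measure]_s (f s)%:E)%E +oo%E.
  exact: leey.
rewrite -ltey => Ifin.
have intf : lebesgue_measure.-integrable setT (EFin \o f).
  apply/integrableP; split; first exact/measurable_EFinP.
  by under eq_integral do rewrite /= ger0_norm//.
pose c := fun s => \int[lebesgue_measure]_(r in `]-oo, s]) f r.
have cE s : (\int[lebesgue_measure]_(r in `]-oo, s]) (f r)%:E = (c s)%:E)%E.
  by rewrite fineK//; apply: integrable_fin_num => //; exact: integrableS intf.
under eq_integral do rewrite cE [expeR _]/=.
pose I := \int[lebesgue_measure]_s f s.
have IE : (\int[lebesgue_measure]_s (f s)%:E = I%:E)%E.
  by rewrite fineK//; apply: integrable_fin_num.
have cI s : c s <= I.
  by rewrite -lee_fin -cE -IE; apply: ge0_subset_integral => //;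
    [exact/measurable_EFinP|move=> ? _; rewrite lee_fin].
have c0 s : 0 <= c s by rewrite -lee_fin -cE.
have cnd : nondecreasing_fun c.
  move=> a s as_; rewrite -lee_fin -!cE; apply: ge0_subset_integral => //.
  - exact/measurable_EFinP/measurable_funTS.
  - by move=> ? _; rewrite lee_fin.
  - by move=> x/=; rewrite !in_itv/= => /le_trans; apply.
have mc : measurable_fun setT c by exact: nondecreasing_measurable.
have bnd (delta : R) : 0 < delta ->
    (\int[lebesgue_measure]_s ((f s)%:E * (expR (c s))%:E) <=
     (expR delta * (expR I - 1))%:E)%E.
  move=> d0.
  have TE : [set: R] = \bigcup_n (`](- n%:R)%R, n%:R]%classic : set R).
    apply/seteqP; split => // x _.
    have xn := archi_boundP (normr_ge0 x).
    exists (Num.bound `|x|) => //=; rewrite in_itv/=.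
    by move: xn; rewrite ltr_norml => /andP[-> /ltW].
  have mg : measurable_fun setT (fun s => ((f s)%:E * (expR (c s))%:E)%E).
    apply/measurable_EFinP.
    by apply: measurable_funM => //; apply: measurableT_comp.
  rewrite [X in (\int[_]_(_ in X) _)%E]TE.
  have cv := @ge0_nondecreasing_set_cvg_integral _ (measurableTypeR R) R
    (fun n => `](- n%:R)%R, n%:R]%classic)
    (fun s => ((f s)%:E * (expR (c s))%:E)%E) lebesgue_measure.
  rewrite -(cvg_lim _ (cv _ _ _ _))//; first last.
  - by move=> n x _; rewrite lee_fin mulr_ge0// expR_ge0.
  - by move=> n; exact: measurable_funTS.
  - move=> m n mn; rewrite subsetEset => x/=; rewrite !in_itv/= => /andP[h1 h2].
    have mn' : m%:R <= n%:R :> R by rewrite ler_nat.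
    apply/andP; split; lra.
  apply: lime_le.
    apply/cvg_ex; eexists; apply: cv => //.
    - move=> m n mn; rewrite subsetEset => x/=; rewrite !in_itv/= => /andP[h1 h2].
      have mn' : m%:R <= n%:R :> R by rewrite ler_nat.
      apply/andP; split; lra.
    - by move=> n; exact: measurable_funTS.
    - by move=> n x _; rewrite lee_fin mulr_ge0// expR_ge0.
  apply: nearW => n.
  have nn : - n%:R <= n%:R :> R by rewrite ge0_cp.
  apply: (@le_trans _ _ ((expR delta * (expR (c n%:R) - expR (c (- n%:R))))%:E)).
    exact: (exp_integral_itv_le d0 f0 intf nn).
  rewrite lee_fin ler_wpM2l ?expR_ge0// lerB ?ler_expR//.
  by rewrite -[leLHS]expR0 ler_expR.
rewrite IE /=.
set J := (\int[_]_s _)%E in bnd *.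
have J0 : (0 <= J)%E.
  by apply: integral_ge0 => s _; rewrite lee_fin mulr_ge0// expR_ge0.
have Jfin : J \is a fin_num.
  by rewrite ge0_fin_numE// (le_lt_trans (bnd 1 ltr01))// ltry.
rewrite -(fineK Jfin) -EFinD lee_fin.
suff : fine J <= expR I - 1 by lra.
apply/ler_addgt0Pr => e e0.
have {}bnd delta : 0 < delta -> fine J <= expR delta * (expR I - 1).
  by move=> /bnd; rewrite -{1}(fineK Jfin) lee_fin.
set K := expR I - 1 in bnd *.
have K0 : 0 <= K.
  by rewrite subr_ge0 -[leLHS]expR0 ler_expR (le_trans (c0 0) (cI 0)).
(* With this choice [expR d * K = K + e * K / (K + 1) <= K + e]; the denominator [K + 1] stays
   positive when [K = 0]. *)
pose d := ln (1 + e / (K + 1)).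
have q0 : 0 < e / (K + 1) by rewrite divr_gt0// ltr_wpDl.
apply: (le_trans (bnd d _)); first by rewrite /d ln_gt0// ltrDl.
rewrite /d lnK ?posrE ?addr_gt0// mulrDl mul1r lerD2l.
by rewrite -mulrA ler_piMr ?ltW// mulrC ltr_pdivrMr ?ltr_wpDl// mul1r ltrDl.
Qed.

(** * Sub-sigma-algebras and conditional expectations *)

(** Only the level sets of [h] are tested. When [h] is measurable for a sub-sigma-algebra they
    belong to it, so an inequality known on its events extends to the weight [h], even if [h] is
    unbounded or infinite. *)
Lemma le_integral_weight d (T : measurableType d) (R : realType)
    (P : probability T R) (h f g : T -> \bar R) :
  measurable_fun setT h -> measurable_fun setT f -> measurable_fun setT g ->
  (forall w, 0 <= h w)%E -> (forall w, 0 <= f w)%E -> (forall w, 0 <= g w)%E ->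
  (forall u : R, \int[P]_(w in [set w | (u%:E < h w)%E]) f w <=
                 \int[P]_(w in [set w | (u%:E < h w)%E]) g w)%E ->
  (\int[P]_w (h w * f w) <= \int[P]_w (h w * g w))%E.
Proof.
move=> mh mf mg h0 f0 g0 fg.
(* Layer cake: [h * e] is the integral over [u >= 0] of [e] on [u < h]. *)
pose k (e : T -> \bar R) (z : R * T) : \bar R :=
  if (0 <= z.1) && (z.1%:E < h z.2)%E then e z.2 else 0%E.
have mS : measurable_fun setT (fun z : R * T => (0 <= z.1) && (z.1%:E < h z.2)%E).
  apply: measurable_and.
    by apply: measurable_fun_ler => //; exact: measurable_fst.
  apply: measurable_fun_lte; first by apply/measurable_EFinP; exact: measurable_fst.
  exact: measurableT_comp.
have mk e : measurable_fun setT e -> measurable_fun setT (k e).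
  by move=> me; apply: measurable_fun_ifT => //; exact: measurableT_comp.
have k0 e : (forall w, 0 <= e w)%E -> forall z, (0 <= k e z)%E.
  by move=> e0 z; rewrite /k; case: ifP.
have S_itv w : exists2 i : interval R,
    [set u : R | (0 <= u) && (u%:E < h w)%E] = [set` i] &
    lebesgue_measure [set` i] = h w.
  have := h0 w; case: (h w) => [r| |//] r0.
  - exists `[0, r[; first by apply/seteqP; split => u /=; rewrite in_itv/= lte_fin.
    rewrite lebesgue_measure_itv/= lte_fin sube0.
    by move: r0; rewrite lee_fin le_eqVlt => /predU1P[<-|->//]; rewrite ltxx.
  - exists `[0, +oo[; last by rewrite lebesgue_measure_itv/= ltry.
    by apply/seteqP; split => u /=; rewrite in_itv/= ltry ?andbT.
have intk e w : (\int[lebesgue_measure]_u k e (u, w) = e w * h w)%E.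
  have [i iE {1}<-] := S_itv w.
  rewrite -integral_cst// -iE.
  rewrite [RHS]integral_mkcond; apply: eq_integral => u _.
  rewrite /k patchE/=; case: ifPn => [uS|uS].
    by rewrite mem_set.
  by rewrite memNset//=; exact/negP.
have swap e : measurable_fun setT e -> (forall w, 0 <= e w)%E ->
    (\int[P]_w (h w * e w) =
     \int[lebesgue_measure]_u \int[P]_w k e (u, w))%E.
  move=> me e0.
  transitivity (\int[P]_w \int[lebesgue_measure]_u k e (u, w))%E.
    by apply: eq_integral => w _; rewrite intk muleC.
  apply/esym; apply: (@fubini_tonelli _ _ _ _ R lebesgue_measure P (k e)).
    exact: mk.
  exact: k0.
rewrite !swap//.
have kE e u : (\int[P]_w k e (u, w) = if (0 <= u)%R then
    \int[P]_(w in [set w | (u%:E < h w)%E]) e w else 0)%E.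
  rewrite /k/=; case: ifPn => u0 /=; last by rewrite integral0.
  rewrite [RHS]integral_mkcond; apply: eq_integral => w _.
  by rewrite patchE/= mem_setE.
apply: ge0_le_integral => //.
- by move=> u _; apply: integral_ge0 => w _; exact: k0.
- by apply: (measurable_fun_fubini_tonelli_F (k f)); [exact: mk|exact: k0].
- by apply: (measurable_fun_fubini_tonelli_F (k g)); [exact: mk|exact: k0].
- by move=> u _; rewrite !kE; case: ifP.
Qed.

Section sub_sigma_algebra.
Context d (T : measurableType d) (R : realType) (P : probability T R).
Context (G : set (set T)).
Hypotheses (Gs : sigma_algebra setT G) (Gm : G `<=` measurable).

(** [G] is already a sigma-algebra, so generating adds nothing: [g_sigma_algebraType G] is the
    sample space equipped with [G], and measurability with respect to [G] becomes ordinary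
    measurability on that type. *)
Lemma g_sigma_measurableE (A : set (g_sigma_algebraType G)) :
  measurable A <-> G A.
Proof. by rewrite measurable_g_measurableTypeE. Qed.

Lemma g_sigma_measurable_id :
  measurable_fun setT (idfun : T -> g_sigma_algebraType G).
Proof. by move=> _ A /g_sigma_measurableE /Gm; rewrite setTI. Qed.

Lemma meas_wrtEP (Y : T -> \bar R) : meas_wrtE G Y <->
  measurable_fun setT (Y : g_sigma_algebraType G -> \bar R).
Proof.
split=> [GY _ B mB|mY B mB]; first by rewrite setTI; apply/g_sigma_measurableE/GY.
by apply/g_sigma_measurableE; rewrite -[_ @^-1` _]setTI; exact: mY.
Qed.

Lemma meas_wrtP (Y : T -> R) : meas_wrt G Y <->
  measurable_fun setT (Y : g_sigma_algebraType G -> R).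
Proof.
split=> [GY _ B mB|mY B mB]; first by rewrite setTI; apply/g_sigma_measurableE/GY.
by apply/g_sigma_measurableE; rewrite -[_ @^-1` _]setTI; exact: mY.
Qed.

Lemma g_sigma_measurable_fun d' (U : measurableType d') (Y : T -> U) :
  measurable_fun setT (Y : g_sigma_algebraType G -> U) -> measurable_fun setT Y.
Proof. by move=> mY; exact: (measurableT_comp mY g_sigma_measurable_id). Qed.

(** The Radon-Nikodym derivative, on [G], of the measure with density [Z] against the restriction of
    [P]. The hypothesis of the theorem speaks of every version [Y] of a conditional expectation, so
    using it requires producing one. *)
Lemma exists_condexp (Z : T -> \bar R) :
  measurable_fun setT Z -> (forall w, 0 <= Z w)%E -> (\int[P]_w Z w < +oo)%E ->
  exists Y, is_condexp P G Z Y.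
Proof.
move=> mZ Z0 Zfin.
have GmT (A : set (g_sigma_algebraType G)) : measurable A -> measurable (A : set T).
  by move=> mA; apply: Gm; apply/g_sigma_measurableE.
pose TG := g_sigma_algebraType G.
have mid : measurable_fun setT (idfun : T -> TG) := g_sigma_measurable_id.
(* The pushforward along the identity is [P] restricted to [G]. *)
pose mu0 : set TG -> \bar R := pushforward P (idfun : T -> TG).
pose nu0 (A : set TG) : \bar R := (\int[P]_(w in A) Z w)%E.
have mu_0 : mu0 set0 = 0%E by exact: measure0.
have mu_ge0 A : (0 <= mu0 A)%E by exact: measure_ge0.
have mu_sa : semi_sigma_additive mu0.
  move=> F mF tF mUF; apply: (@measure_semi_sigma_additive _ _ _ P) => //.
  - by move=> i; apply: (GmT (F i)); exact: (mF i).
  - exact: (GmT _ mUF).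
have nu_0 : nu0 set0 = 0%E by exact: integral_set0.
have nu_ge0 A : (0 <= nu0 A)%E by exact: integral_ge0.
have nu_sa : semi_sigma_additive nu0.
  move=> F mF tF mUF; apply: (semi_sigma_additive_nng_induced mZ Z0) => //.
  - by move=> i; apply: (GmT (F i)); exact: (mF i).
  - exact: (GmT _ mUF).
pose muM := isMeasure.Build _ TG R mu0 mu_0 mu_ge0 mu_sa.
pose mu : {measure set TG -> \bar R} := HB.pack mu0 muM.
have mu_fin : fin_num_fun mu.
  by move=> A mA; apply: fin_num_measure; exact: GmT.
pose muF : {finite_measure set TG -> \bar R} :=
  HB.pack (mu : set TG -> \bar R) mu (Measure_isFinite.Build _ TG R mu mu_fin).
pose nuM := isMeasure.Build _ TG R nu0 nu_0 nu_ge0 nu_sa.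
pose nu : {measure set TG -> \bar R} := HB.pack nu0 nuM.
have nu_fin : fin_num_fun nu.
  move=> A mA; rewrite ge0_fin_numE//; apply: le_lt_trans Zfin.
  by apply: ge0_subset_integral => //; exact: GmT.
pose nuF : {finite_measure set TG -> \bar R} :=
  HB.pack (nu : set TG -> \bar R) nu (Measure_isFinite.Build _ TG R nu nu_fin).
have numu : nuF `<< muF.
  apply/null_content_dominatesP => A mA muA.
  rewrite /= /nu0; apply: null_set_integral => //.
  - exact: GmT.
  - exact: measurable_funTS.
have [Y [Y0 Yint YE]] := radon_nikodym_finite numu.
have mY : measurable_fun setT Y by exact: measurable_int Yint.
exists Y; split => //; first exact/meas_wrtEP.
move=> A GA; have mA : measurable (A : set TG) by exact/g_sigma_measurableE.
have := YE A mA; rewrite [in LHS]/= /nu0 => ->.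
rewrite (ge0_integral_pushforward mid)//.
exact: measurable_funTS.
Qed.

End sub_sigma_algebra.

(** * The Gronwall cancellation *)

(** The moving domain becomes an indicator inside the integrand, and the pair of time and sample
    point becomes the parameter of a section integral, to which Tonelli's measurability statement
    applies. *)
Lemma measurable_integral_section d (T : measurableType d) (R : realType)
    (b : R -> R -> bool) (g : R -> T -> \bar R) :
  measurable_fun setT (fun z : R * R => b z.1 z.2) ->
  measurable_fun setT (fun z : R * T => g z.1 z.2) ->
  (forall s w, 0 <= g s w)%E ->
  measurable_fun setT (fun z : R * T =>
    \int[lebesgue_measure]_(r in [set r : R | b z.1 r]) g r z.2)%E.
Proof.
move=> mb mg g0.
rewrite (_ : (fun z : R * T => _) = fun z : R * T =>
    \int[lebesgue_measure]_r (if b z.1 r then g r z.2 else 0))%E; last first.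
  apply/funext => z; rewrite integral_mkcond; apply: eq_integral => r _.
  by rewrite patchE mem_setE.
pose f (y : (R * T) * R) := if b y.1.1 y.2 then g y.2 y.1.2 else 0%E.
have mf : measurable_fun setT f.
  apply: measurable_fun_ifT => //.
  - apply: (measurableT_comp (g := fun y : (R * T) * R => (y.1.1, y.2)) mb).
    apply: measurable_fun_pair; last exact: measurable_snd.
    exact: (measurableT_comp measurable_fst measurable_fst).
  - apply: (measurableT_comp (g := fun y : (R * T) * R => (y.2, y.1.2)) mg).
    apply: measurable_fun_pair; first exact: measurable_snd.
    exact: (measurableT_comp measurable_snd measurable_fst).
apply: (@measurable_fun_fubini_tonelli_F _ _ _ _ R lebesgue_measure f mf).
by move=> y; rewrite /f; case: ifP.
Qed.

Lemma measurable_integral_Nyc d (T : measurableType d) (R : realType)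
    (g : R -> T -> \bar R) :
  measurable_fun setT (fun z : R * T => g z.1 z.2) ->
  (forall s w, 0 <= g s w)%E ->
  measurable_fun setT (fun z : R * T =>
    \int[lebesgue_measure]_(r in `]-oo, z.1]) g r z.2)%E.
Proof.
move=> mg g0.
under eq_fun do rewrite set_itvNyc.
apply: (@measurable_integral_section _ T R (fun s r => r <= s) g _ mg g0).
by apply: measurable_fun_ler; [exact: measurable_snd|exact: measurable_fst].
Qed.

Lemma measurable_integral_cy d (T : measurableType d) (R : realType)
    (g : R -> T -> \bar R) :
  measurable_fun setT (fun z : R * T => g z.1 z.2) ->
  (forall s w, 0 <= g s w)%E ->
  measurable_fun setT (fun z : R * T =>
    \int[lebesgue_measure]_(r in `[z.1, +oo[) g r z.2)%E.
Proof.
move=> mg g0.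
under eq_fun do rewrite set_itvcy.
apply: (@measurable_integral_section _ T R (fun s r => s <= r) g _ mg g0).
by apply: measurable_fun_ler; [exact: measurable_fst|exact: measurable_snd].
Qed.

(** Apply [exp_integral_le] to [f] set to 0 after [t]: for [s <= t] the inner integral is unchanged,
    and for later [s] the outer factor vanishes. *)
Lemma exp_integral_Nyc_le (R : realType) (f : R -> R) (t : R) :
  measurable_fun setT f -> (forall s, 0 <= f s) ->
  (1 + \int[lebesgue_measure]_(s in `]-oo, t]) ((f s)%:E *
       expeR (\int[lebesgue_measure]_(r in `]-oo, s]) (f r)%:E)) <=
   expeR (\int[lebesgue_measure]_(s in `]-oo, t]) (f s)%:E))%E.
Proof.
move=> mf f0.
pose g := f \_ `]-oo, t]%classic.
have mg : measurable_fun setT g.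
  by apply/(measurable_restrictT _ _).1 => //; exact: measurable_funTS.
have g0 s : 0 <= g s by rewrite /g patchE; case: ifP.
have -> : (\int[lebesgue_measure]_(s in `]-oo, t]) (f s)%:E =
    \int[lebesgue_measure]_s (g s)%:E)%E.
  by rewrite integral_mkcond; apply: eq_integral => s _; rewrite restrict_EFin.
have -> : (\int[lebesgue_measure]_(s in `]-oo, t]) ((f s)%:E *
      expeR (\int[lebesgue_measure]_(r in `]-oo, s]) (f r)%:E)) =
    \int[lebesgue_measure]_s ((g s)%:E *
      expeR (\int[lebesgue_measure]_(r in `]-oo, s]) (g r)%:E)))%E.
  rewrite integral_mkcond; apply: eq_integral => s _.
  rewrite patchE [in RHS]/g [in RHS]patchE; case: ifPn => [/set_mem/=st|_]; last by rewrite mul0e.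
  congr (_ * expeR _)%E; apply: eq_integral => r /set_mem/= rs.
  rewrite /g patchE mem_set//=; move: rs st; rewrite !in_itv/=; exact: le_trans.
exact: exp_integral_le.
Qed.

Section path.
Context (R : realType) (l : R) (al x : R -> R).
Hypotheses (l0 : 0 <= l) (mal : measurable_fun setT al) (mx : measurable_fun setT x).
Hypotheses (al0 : forall s, 0 <= al s) (x0 : forall s, 0 <= x s).
Let E s := expeR (\int[lebesgue_measure]_(r in `]-oo, s]) (l * al r)%:E)%E.

(** The second term is the contribution to [N] of one path, in the form in which the tested
    hypothesis produces it. Tonelli on the triangle [s <= r] turns the tail of [al * x] into the
    factor [k r], and [exp_integral_Nyc_le] bounds [1 + k r] by [E r]. *)
Lemma path_gronwall_le :
  (\int[lebesgue_measure]_s ((al s)%:E * (x s)%:E) +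
   \int[lebesgue_measure]_s ((al s)%:E * E s *
      (l%:E * \int[lebesgue_measure]_(r in `[s, +oo[) ((al r)%:E * (x r)%:E))) <=
   \int[lebesgue_measure]_s ((al s)%:E * E s * (x s)%:E))%E.
Proof.
have mE : measurable_fun setT E.
  apply: measurableT_comp; first exact: measurable_expeR.
  (* The second coordinate is a dummy sample point, frozen at 0 afterwards. *)
  have h : measurable_fun setT (fun z : R * R =>
      \int[lebesgue_measure]_(r in `]-oo, z.1]) (l * al r)%:E)%E.
    apply: (@measurable_integral_Nyc _ R R (fun r _ => (l * al r)%:E)).
      apply/measurable_EFinP; apply: measurable_funM => //.
      exact: (measurableT_comp mal measurable_fst).
    by move=> s w; rewrite lee_fin mulr_ge0.
  exact: (measurable_fun_pair1 (0 : R) h).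
have E0 s : (0 <= E s)%E by exact: expeR_ge0.
have max : measurable_fun setT (fun s => (al s)%:E * (x s)%:E)%E.
  by apply: emeasurable_funM; exact/measurable_EFinP.
pose Psi (z : R * R) : \bar R := if z.1 <= z.2 then
  ((l%:E * (al z.1)%:E * E z.1) * ((al z.2)%:E * (x z.2)%:E))%E else 0%E.
have Psi0 z : (0 <= Psi z)%E.
  rewrite /Psi; case: ifP => // _.
  by rewrite !mule_ge0 ?lee_fin.
have mPsi : measurable_fun setT Psi.
  apply: measurable_fun_ifT => //.
    by apply: measurable_fun_ler; [exact: measurable_fst|exact: measurable_snd].
  apply: emeasurable_funM; last exact: (measurableT_comp max measurable_snd).
  apply: emeasurable_funM; last exact: (measurableT_comp mE measurable_fst).
  apply: measurable_funeM; apply/measurable_EFinP.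
  exact: (measurableT_comp mal measurable_fst).
have axi0 (D : set R) : (0 <= \int[lebesgue_measure]_(r in D) ((al r)%:E * (x r)%:E))%E.
  by apply: integral_ge0 => r _; rewrite mule_ge0 ?lee_fin.
have eN : (\int[lebesgue_measure]_s ((al s)%:E * E s *
      (l%:E * \int[lebesgue_measure]_(r in `[s, +oo[) ((al r)%:E * (x r)%:E))) =
    \int[lebesgue_measure]_r (((al r)%:E * (x r)%:E) *
      \int[lebesgue_measure]_(s in `]-oo, r]) ((l * al s)%:E * E s)))%E.
  transitivity (\int[lebesgue_measure]_s \int[lebesgue_measure]_r Psi (s, r))%E.
    apply: eq_integral => s _.
    rewrite muleA [(_ * l%:E)%E]muleC muleA -ge0_integralZl//.
    - rewrite [LHS]integral_mkcond; apply: eq_integral => r _.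
      by rewrite patchE mem_setE /Psi/= in_itv/= andbT.
    - exact: measurable_funTS.
    - by move=> r _; rewrite mule_ge0 ?lee_fin.
    - by rewrite !mule_ge0 ?lee_fin.
  transitivity (\int[lebesgue_measure]_r \int[lebesgue_measure]_s Psi (s, r))%E.
    exact: (@fubini_tonelli _ _ _ _ R lebesgue_measure lebesgue_measure Psi).
  apply: eq_integral => r _.
  rewrite muleC -ge0_integralZr//.
  - rewrite [RHS]integral_mkcond; apply: eq_integral => s _.
    by rewrite patchE mem_setE /Psi/= in_itv/= EFinM.
  - apply: measurable_funTS; apply: emeasurable_funM => //.
    by apply/measurable_EFinP; exact: measurable_funM.
  - by move=> s _; rewrite mule_ge0 ?lee_fin// mulr_ge0.
  - by rewrite mule_ge0 ?lee_fin.
have mlaE : measurable_fun setT (fun s => (l * al s)%:E * E s)%E.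
  by apply: emeasurable_funM => //; apply/measurable_EFinP; exact: measurable_funM.
have laE0 s : (0 <= (l * al s)%:E * E s)%E.
  by rewrite mule_ge0 ?lee_fin// mulr_ge0.
have mk : measurable_fun setT (fun r : R =>
    \int[lebesgue_measure]_(s in `]-oo, r]) ((l * al s)%:E * E s))%E.
  have h : measurable_fun setT (fun z : R * R =>
      \int[lebesgue_measure]_(s in `]-oo, z.1]) ((l * al s)%:E * E s))%E.
    apply: (@measurable_integral_Nyc _ R R (fun s _ => (l * al s)%:E * E s)%E) => //.
    exact: (measurableT_comp mlaE measurable_fst).
  exact: (measurable_fun_pair1 (0 : R) h).
have k0 r : (0 <= \int[lebesgue_measure]_(s in `]-oo, r]) ((l * al s)%:E * E s))%E.
  exact: integral_ge0.
rewrite eN -ge0_integralD//; first last.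
- exact: emeasurable_funM.
- by move=> r _; rewrite !mule_ge0 ?lee_fin.
- by move=> r _; rewrite !mule_ge0 ?lee_fin.
apply: ge0_le_integral => //.
- by move=> r _; rewrite adde_ge0// !mule_ge0 ?lee_fin.
- by apply: emeasurable_funD => //; exact: emeasurable_funM.
- apply: emeasurable_funM; last exact/measurable_EFinP.
  by apply: emeasurable_funM => //; exact/measurable_EFinP.
- move=> r _; rewrite -{1}[((al r)%:E * (x r)%:E)%E]mule1 -ge0_muleDr//.
  rewrite [leRHS]muleAC lee_wpmul2l ?mule_ge0 ?lee_fin//.
  apply: exp_integral_Nyc_le; first exact: measurable_funM.
  by move=> s; rewrite mulr_ge0.
Qed.

End path.

Section weighted_gronwall.
Context d (T : measurableType d) (R : realType) (P : probability T R).
Context (l : R) (al x : R -> T -> R) (xi : T -> R).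
Hypotheses (l0 : 0 <= l)
  (mal : measurable_fun setT (fun z : R * T => al z.1 z.2))
  (mx : measurable_fun setT (fun z : R * T => x z.1 z.2))
  (mxi : measurable_fun setT xi).
Hypotheses (al0 : forall s w, 0 <= al s w) (x0 : forall s w, 0 <= x s w)
  (xi0 : forall w, 0 <= xi w).
Let E s w := expeR (\int[lebesgue_measure]_(r in `]-oo, s]) (l * al r w)%:E)%E.
Let tail s w := (\int[lebesgue_measure]_(r in `[s, +oo[) ((al r w)%:E * (x r w)%:E))%E.

(** The cancellation itself, with the filtration abstracted away: adaptedness enters only through
    the first premise, where the hypothesis has already been tested against the weight at each
    time. *)
Lemma weighted_gronwall :
  (forall s, \int[P]_w ((al s w)%:E * E s w * (x s w)%:E) <=
             \int[P]_w ((al s w)%:E * E s w * ((xi w)%:E + l%:E * tail s w)))%E ->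
  (\int[P]_w \int[lebesgue_measure]_s ((al s w)%:E * E s w * (x s w)%:E) < +oo)%E ->
  (\int[P]_w \int[lebesgue_measure]_s ((al s w)%:E * (x s w)%:E) <=
   \int[P]_w ((xi w)%:E * \int[lebesgue_measure]_s ((al s w)%:E * E s w)))%E.
Proof.
move=> hyp fin.
have malE : measurable_fun setT (fun z : R * T => (al z.1 z.2)%:E).
  exact/measurable_EFinP.
have mE : measurable_fun setT (fun z : R * T => E z.1 z.2).
  apply: measurableT_comp; first exact: measurable_expeR.
  apply: (@measurable_integral_Nyc _ T R (fun r w => (l * al r w)%:E)).
    by apply/measurable_EFinP; exact: measurable_funM.
  by move=> s w; rewrite lee_fin mulr_ge0.
have E0 s w : (0 <= E s w)%E by exact: expeR_ge0.
have max : measurable_fun setT (fun z : R * T => (al z.1 z.2)%:E * (x z.1 z.2)%:E)%E.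
  by apply: emeasurable_funM => //; exact/measurable_EFinP.
have ax0 s w : (0 <= (al s w)%:E * (x s w)%:E)%E by rewrite mule_ge0 ?lee_fin.
have mtail : measurable_fun setT (fun z : R * T => tail z.1 z.2).
  exact: (@measurable_integral_cy _ T R (fun r w => (al r w)%:E * (x r w)%:E)%E).
have tail0 s w : (0 <= tail s w)%E by exact: integral_ge0.
have mh : measurable_fun setT (fun z : R * T => (al z.1 z.2)%:E * E z.1 z.2)%E.
  exact: emeasurable_funM.
have h0 s w : (0 <= (al s w)%:E * E s w)%E by rewrite mule_ge0 ?lee_fin.
(* Integrated over time and sample points, [fL] gives [L], [fN] gives [N], [fM] the unweighted
   quantity to be bounded, and [fB] its bound. *)
pose fL (z : R * T) := ((al z.1 z.2)%:E * E z.1 z.2 * (x z.1 z.2)%:E)%E.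
pose fN (z : R * T) := ((al z.1 z.2)%:E * E z.1 z.2 * (l%:E * tail z.1 z.2))%E.
pose fM (z : R * T) := ((al z.1 z.2)%:E * (x z.1 z.2)%:E)%E.
pose fK (z : R * T) := ((al z.1 z.2)%:E * E z.1 z.2)%E.
pose fB (z : R * T) := (fK z * (xi z.2)%:E)%E.
have mfL : measurable_fun setT fL.
  by apply: emeasurable_funM => //; exact/measurable_EFinP.
have mfN : measurable_fun setT fN.
  by apply: emeasurable_funM => //; exact: measurable_funeM.
have mfB : measurable_fun setT fB.
  apply: emeasurable_funM => //.
  by apply/measurable_EFinP; exact: (measurableT_comp mxi measurable_snd).
have fL0 z : (0 <= fL z)%E by rewrite mule_ge0 ?lee_fin.
have fN0 z : (0 <= fN z)%E by rewrite !mule_ge0 ?lee_fin.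
have fM0 z : (0 <= fM z)%E by exact: ax0.
have fK0 z : (0 <= fK z)%E by exact: h0.
have fB0 z : (0 <= fB z)%E by rewrite !mule_ge0 ?lee_fin.
have mG (f : R * T -> \bar R) : measurable_fun setT f -> (forall z, 0 <= f z)%E ->
    measurable_fun setT (fun w : T => \int[lebesgue_measure]_s f (s, w))%E.
  move=> mf f0.
  exact: (@measurable_fun_fubini_tonelli_G _ _ _ _ R lebesgue_measure f mf f0).
have swap (f : R * T -> \bar R) : measurable_fun setT f -> (forall z, 0 <= f z)%E ->
    (\int[P]_w \int[lebesgue_measure]_s f (s, w) =
     \int[lebesgue_measure]_s \int[P]_w f (s, w))%E.
  move=> mf f0; apply/esym.
  exact: (@fubini_tonelli _ _ _ _ R lebesgue_measure P f mf f0).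
have mF (f : R * T -> \bar R) : measurable_fun setT f -> (forall z, 0 <= f z)%E ->
    measurable_fun setT (fun s : R => \int[P]_w f (s, w))%E.
  move=> mf f0.
  exact: (@measurable_fun_fubini_tonelli_F _ _ _ _ R P f mf f0).
pose I (f : R * T -> \bar R) := (\int[P]_w \int[lebesgue_measure]_s f (s, w))%E.
have I0 f : (forall z, 0 <= f z)%E -> (0 <= I f)%E.
  by move=> f0; apply: integral_ge0 => w _; apply: integral_ge0 => s _.
have MNL : (I fM + I fN <= I fL)%E.
  rewrite /I -ge0_integralD//.
  - apply: ge0_le_integral => //.
    + by move=> w _; rewrite adde_ge0// integral_ge0.
    + by apply: emeasurable_funD; exact: mG.
    + exact: mG.
    + move=> w _; apply: path_gronwall_le => //.
      * exact: (measurable_fun_pair1 w mal).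
      * exact: (measurable_fun_pair1 w mx).
  - by move=> w _; exact: integral_ge0.
  - exact: mG.
  - by move=> w _; exact: integral_ge0.
  - exact: mG.
(* Time becomes the outer variable here, so that the premise can be used at a fixed [s]. *)
have LBN : (I fL <= I fB + I fN)%E.
  rewrite /I !swap// -ge0_integralD//.
  - apply: ge0_le_integral => //.
    + by move=> s _; exact: integral_ge0.
    + exact: mF.
    + by apply: emeasurable_funD; exact: mF.
    + move=> s _; apply: (le_trans (hyp s)).
      rewrite -ge0_integralD//.
      * rewrite le_eqVlt; apply/orP; left; apply/eqP; apply: eq_integral => w _.
        by rewrite ge0_muleDr ?mule_ge0 ?lee_fin.
      * exact: (measurable_fun_pair2 s mfB).
      * exact: (measurable_fun_pair2 s mfN).
  - by move=> s _; exact: integral_ge0.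
  - exact: mF.
  - by move=> s _; exact: integral_ge0.
  - exact: mF.
have BE : I fB = (\int[P]_w ((xi w)%:E * \int[lebesgue_measure]_s fK (s, w)))%E.
  apply: eq_integral => w _; rewrite muleC -ge0_integralZr//.
  - exact: (measurable_fun_pair1 w mh).
  - by rewrite lee_fin.
rewrite -BE.
(* [MNL] bounds [N] by the finite [L]; the bound [I fB] itself may be infinite. *)
have Nfin : I fN \is a fin_num.
  rewrite ge0_fin_numE; last exact: I0.
  apply: le_lt_trans fin.
  by apply: le_trans MNL; apply: leeDr; exact: I0.
by rewrite -(leeD2rE _ _ Nfin); exact: le_trans MNL LBN.
Qed.

End weighted_gronwall.

(** * Filtrations and progressive processes *)

Section filtration.
Context d (T : measurableType d) (R : realType) (P : probability T R).
Context (dim : nat) (B : 'I_dim -> R -> T -> R).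

Lemma brownian_filtration_sigma_algebra t :
  sigma_algebra setT (brownian_filtration P B t).
Proof.
split.
- by move=> u _; exact: sigma_algebra0.
- by move=> A FA u tu; apply: sigma_algebraCD; exact: FA.
- by move=> A FA u tu; apply: sigma_algebra_bigcup => n; exact: FA.
Qed.

Lemma brownian_filtration_mono s t : s <= t ->
  brownian_filtration P B s `<=` brownian_filtration P B t.
Proof. by move=> st A FA u tu; apply: FA; exact: le_lt_trans tu. Qed.

Lemma brownian_filtration_measurable t : (forall i s, measurable_fun setT (B i s)) ->
  brownian_filtration P B t `<=` measurable.
Proof.
(* Right-continuity is encoded as an intersection over all [u > t]; the instance [u = t + 1]
   suffices here. *)
move=> mB A /(_ (t + 1)); rewrite ltrDl => /(_ ltr01); apply.
split; first exact: sigma_algebra_measurable.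
move=> C [|[]//]; apply.
split; first exact: sigma_algebra_measurable.
by move=> D [i [s [S [_ mS ->]]]]; rewrite -[_ @^-1` _]setTI; exact: mB.
Qed.

End filtration.

Section adapted_processes.
Context d (T : measurableType d) (R : realType) (F : R -> set (set T)).
Hypotheses (Fs : forall t, sigma_algebra setT (F t))
  (Fm : forall t, F t `<=` measurable)
  (Fmono : forall s t, s <= t -> F s `<=` F t).

(** Extending by 0 outside [[0, t]] trades the trace sigma-algebra in [progressive] for an ordinary
    product with [F t], on which Tonelli can be used. *)
Lemma progressive_measurable_fun (y : R -> T -> R) (t : R) :
  progressive F y -> 0 <= t ->
  measurable_fun setT (fun z : R * g_sigma_algebraType (F t) =>
    if 0 <= z.1 <= t then y z.1 z.2 else 0).
Proof.
move=> yprog t0; pose TG := g_sigma_algebraType (F t).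
pose D : set (R * TG) := [set z | 0 <= z.1 <= t].
have mI : measurable [set s : R | 0 <= s <= t].
  have -> : [set s : R | 0 <= s <= t] = `[0, t]%classic.
    by apply/seteqP; split=> s /=; rewrite in_itv.
  exact: measurable_itv.
have DE : D = [set s : R | 0 <= s <= t] `*` (setT : set TG).
  by apply/seteqP; split => [[s w]//=|[s w] []].
have mD : measurable D by rewrite DE; exact: measurableX.
rewrite (_ : (fun _ => _) = (fun z : R * TG => y z.1 z.2) \_ D); last first.
  by apply/funext => z; rewrite patchE/= mem_setE.
apply/(measurable_restrictT _ _).1 => // _ S mS.
have := yprog t t0 S mS; apply.
(* The generated sigma-algebra is the smallest one on [D] containing the rectangles; the
   product-measurable sets form another, as [D] is itself measurable. *)
split.
- split; first exact: measurable0.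
  + by move=> A mA; exact: measurableD.
  + by move=> A mA; exact: bigcup_measurable.
- move=> _ [I [A [mI' _ FA ->]]]; apply: measurableX => //.
  by apply/g_sigma_measurableE.
Qed.

(** The truncations to [[0, n]] are eventually constant at each point. *)
Lemma progressive_measurable_fun_pos (y : R -> T -> R) : progressive F y ->
  measurable_fun setT (fun z : R * T => if 0 <= z.1 then y z.1 z.2 else 0).
Proof.
move=> yprog.
pose f n (z : R * T) := if 0 <= z.1 <= n%:R then y z.1 z.2 else 0.
apply: (measurable_fun_cvg (h := f)) => //.
- move=> n.
  have h := progressive_measurable_fun yprog (ler0n R n).
  apply: (measurableT_comp (f := fun z : R * g_sigma_algebraType (F n%:R) =>
    if 0 <= z.1 <= n%:R then y z.1 z.2 else 0) h
    (g := fun z : R * T => (z.1, z.2 : g_sigma_algebraType (F n%:R)))).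
  apply: measurable_fun_pair; first exact: measurable_fst.
  exact: (measurableT_comp (g_sigma_measurable_id (Fs _) (@Fm _)) measurable_snd).
- move=> z _; apply: cvg_near_cst.
  have zn := archi_boundP (normr_ge0 z.1).
  near=> n.
  rewrite /f; suff -> : (0 <= z.1 <= n%:R) = (0 <= z.1) by [].
  case: (0 <= z.1) => //=; apply: (le_trans (ler_norm _)); apply: (le_trans (ltW zn)).
  by rewrite ler_nat; near: n; exact: nbhs_infty_ge.
Unshelve. all: by end_near. Qed.

(** The event that the minimum is at most [y] is everything for [t <= y], empty for [y < 0], and
    otherwise the event [tau <= y], which lies in [F y] and hence in [F t]. *)
Lemma stopping_time_measurable_min (tau : T -> \bar R) (t : R) :
  stopping_time F tau ->
  measurable_fun setT (fun w : g_sigma_algebraType (F t) => mine (tau w) t%:E).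
Proof.
move=> [tau0 Ftau].
apply: (measurability (@ErealGenOInfty.G R)); first exact: ErealGenOInfty.measurableE.
move=> _ [_ [y ->] <-]; rewrite setTI.
apply/g_sigma_measurableE; first exact: Fs.
have -> : (fun w => mine (tau w) t%:E) @^-1` `]y%:E, +oo[%classic =
    setT `\` [set w | (mine (tau w) t%:E <= y%:E)%E].
  apply/seteqP; split => w /=; rewrite in_itv/= andbT ltNge.
    by move=> /negP.
  by move=> [_ /negP].
have [F0 FD _] := Fs t; apply: (FD _).
have [ty|yt] := leP t y.
  have -> : [set w | (mine (tau w) t%:E <= y%:E)%E] = setT `\` set0.
    by rewrite setD0; apply/seteqP; split => w //= _; rewrite ge_min lee_fin ty orbT.
  exact: FD.
have tauE : [set w | (mine (tau w) t%:E <= y%:E)%E] = [set w | (tau w <= y%:E)%E].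
  apply/seteqP; split => w /=; rewrite ge_min lee_fin [t <= y]leNgt yt orbF//.
rewrite tauE; have [y0|y0] := leP 0 y; first exact: Fmono (ltW yt) _ (Ftau y y0).
rewrite (_ : [set _ | _] = set0)//; apply/seteqP; split => w //=.
by move=> /(le_trans (tau0 w)); rewrite lee_fin leNgt y0.
Qed.

Lemma stopping_time_measurable (tau : T -> \bar R) :
  stopping_time F tau -> measurable_fun setT tau.
Proof.
move=> [tau0 Ftau].
apply: (measurability (@ErealGenOInfty.G R)); first exact: ErealGenOInfty.measurableE.
move=> _ [_ [y ->] <-]; rewrite setTI.
have -> : tau @^-1` `]y%:E, +oo[%classic = setT `\` [set w | (tau w <= y%:E)%E].
  apply/seteqP; split => w /=; rewrite in_itv/= andbT ltNge.
    by move=> /negP.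
  by move=> [_ /negP].
apply: measurableD => //; have [y0|y0] := leP 0 y; first exact: Fm (Ftau y y0).
rewrite (_ : [set _ | _] = set0)//; apply/seteqP; split => w //=.
by move=> /(le_trans (tau0 w)); rewrite lee_fin leNgt y0.
Qed.

Lemma stopped_sigma_measurable (tau : T -> \bar R) :
  stopped_sigma F tau `<=` measurable.
Proof.
move=> A [+ _]; apply; split; first exact: sigma_algebra_measurable.
by move=> C [t [_ /Fm]].
Qed.

End adapted_processes.

(** * Moment inequalities in the extended reals *)

Section ereal_inequalities.
Context (R : realType).
Implicit Types (p q : R) (u v y : \bar R).

(** Under a probability measure this turns a finite moment of order [p] into a finite mean. *)
Lemma le_1D_poweR y p : 1 <= p -> (0 <= y -> y <= 1 + poweR y p)%E.
Proof.
move=> p1; case: y => [r| |//] r0; last first.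
  by rewrite poweRyr ?addey ?leey// gt_eqF// (lt_le_trans ltr01).
rewrite poweR_EFin -EFinD lee_fin; rewrite lee_fin in r0.
have [r1|r1] := leP r 1; first by rewrite (le_trans r1)// lerDl powR_ge0.
apply: (@le_trans _ _ (r `^ p)); last by rewrite lerDr.
by rewrite -[leLHS]powRr1// ler_powR// ltW.
Qed.

(** Young's inequality with the factors [1/p] and [1/q] bounded by 1. *)
Lemma mule_le_poweRD u v p q : 0 < p -> 0 < q -> p^-1 + q^-1 = 1 ->
  (0 <= u -> 0 <= v -> u * v <= poweR u p + poweR v q)%E.
Proof.
move=> p0 q0 pq; case: u => [r| |//] r0; last first.
  move=> _; rewrite poweRyr ?gt_eqF// addye ?leey//.
  by rewrite gt_eqF// (lt_le_trans _ (poweR_ge0 _ _))// ltNy0.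
case: v => [s| |//] s0; last first.
  rewrite poweRyr ?gt_eqF// addey ?leey//.
rewrite !poweR_EFin -EFinM -EFinD lee_fin; rewrite !lee_fin in r0 s0.
apply: (le_trans (conjugate_powR r0 s0 p0 q0 pq)).
have pV : 0 < p^-1 by rewrite invr_gt0.
have qV : 0 < q^-1 by rewrite invr_gt0.
by apply: lerD; rewrite ler_piMr ?powR_ge0//; lra.
Qed.

Lemma poweR_expeR y q : 0 < q -> poweR (expeR y) q = expeR (q%:E * y).
Proof.
move=> q0; case: y => [r| |].
- by rewrite /= mulrC expRM.
- by rewrite gt0_muley ?lte_fin//= gt_eqF.
- by rewrite gt0_muleNy ?lte_fin//= powR0 ?gt_eqF.
Qed.

End ereal_inequalities.

(** A failure with positive probability would give some event [H n] in [G] positive probability.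
    There [f] exceeds [Y] by at least [1/(n+1)], which contradicts the integrated inequality once
    the finite integral of [Y] is cancelled. *)
Lemma ae_le_of_integral_le d (T : measurableType d) (R : realType)
    (P : probability T R) (G : set (set T)) (f : T -> R) (Y : T -> \bar R) :
  sigma_algebra setT G -> G `<=` measurable ->
  meas_wrt G f -> meas_wrtE G Y -> (forall w, 0 <= f w) -> (forall w, 0 <= Y w)%E ->
  (forall H, G H -> \int[P]_(w in H) (f w)%:E <= \int[P]_(w in H) Y w)%E ->
  {ae P, forall w, ((f w)%:E <= Y w)%E}.
Proof.
move=> Gs Gm /(meas_wrtP Gs) mGf /(meas_wrtEP Gs) mGY f0 Y0 fY.
have mf := g_sigma_measurable_fun Gs Gm mGf.
have mY := g_sigma_measurable_fun Gs Gm mGY.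
(* The upper bound [n] makes the integrals over [H n] finite. *)
pose H n := [set w | (Y w + n.+1%:R^-1%:E <= (f w)%:E)%E && ((f w)%:E <= n%:R%:E)%E].
have GH n : G (H n).
  apply/(g_sigma_measurableE Gs).
  have : measurable_fun setT (fun w : g_sigma_algebraType G =>
      (Y w + n.+1%:R^-1%:E <= (f w)%:E)%E && ((f w)%:E <= n%:R%:E)%E).
    apply: measurable_and; apply: measurable_fun_lee => //.
    - exact: emeasurable_funD.
    - exact/measurable_EFinP.
    - exact/measurable_EFinP.
  by move=> mb; have := mb measurableT [set true] I; rewrite setTI.
have PH n : P (H n) = 0%E.
  have mH := Gm _ (GH n).
  have nV : 0 < n.+1%:R^-1 :> R by rewrite invr_gt0.
  have IYn : (\int[P]_(w in H n) Y w + n.+1%:R^-1%:E * P (H n) <=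
      \int[P]_(w in H n) (f w)%:E)%E.
    rewrite -integral_cst// -ge0_integralD//.
    - apply: ge0_le_integral => //.
      + by move=> w _; rewrite adde_ge0// lee_fin ltW.
      + by apply: emeasurable_funD => //; exact: measurable_funTS.
      + by apply/measurable_EFinP; exact: measurable_funTS.
      + by move=> w /andP[].
    - exact: measurable_funTS.
    - by move=> w _; rewrite lee_fin ltW.
  have IY0 : (0 <= \int[P]_(w in H n) Y w)%E by exact: integral_ge0.
  have Ifin : (\int[P]_(w in H n) (f w)%:E < +oo)%E.
    apply: (@le_lt_trans _ _ (\int[P]_(w in H n) (cst n%:R%:E w))%E).
      apply: ge0_le_integral => //.
      + by move=> w _; rewrite lee_fin.
      + by apply/measurable_EFinP; exact: measurable_funTS.
      + by move=> w /andP[].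
    rewrite integral_cst//; apply: lte_mul_pinfty => //.
    by rewrite (le_lt_trans (probability_le1 P mH))// ltry.
  have PH0 : (0 <= n.+1%:R^-1%:E * P (H n))%E.
    by rewrite mule_ge0// lee_fin ltW.
  have IYfin : (\int[P]_(w in H n) Y w)%E \is a fin_num.
    rewrite ge0_fin_numE//; apply: le_lt_trans Ifin; apply: le_trans IYn.
    exact: leeDl.
  have := le_trans IYn (fY _ (GH n)).
  rewrite -[leRHS]adde0 leeD2lE// => PHle.
  have /eqP : (n.+1%:R^-1%:E * P (H n) = 0)%E by apply/eqP; rewrite eq_le PHle PH0.
  by rewrite mule_eq0 eqe gt_eqF//= => /eqP.
have : P.-negligible (\bigcup_n H n).
  apply: negligible_bigcup => n; exists (H n); split => //.
    exact: Gm.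
  exact: PH.
move=> Hneg; suff: P.-negligible (~` [set w | ((f w)%:E <= Y w)%E]) by [].
apply: negligibleS Hneg => w /= /negP; rewrite -ltNge.
have := Y0 w; case Yw : (Y w) => [y| |]// y0.
rewrite lte_fin -subr_gt0 => yf.
pose n := maxn (Num.bound (f w - y)^-1) (Num.bound (f w)).
have yfV : 0 <= (f w - y)^-1 by rewrite invr_ge0 ltW.
have h1 := archi_boundP yfV.
have h2 := archi_boundP (f0 w).
exists n => //; rewrite /H/= Yw -EFinD !lee_fin; apply/andP; split; last first.
  by apply: (le_trans (ltW h2)); rewrite ler_nat leq_maxr.
rewrite -lerBrDl -[leRHS]invrK lef_pV2 ?posrE ?invr_gt0//.
by apply: (le_trans (ltW h1)); rewrite ler_nat (leq_trans (leq_maxl _ _) (leqnSn _)).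
Qed.

(** Generic in the measurable space because it serves twice: with [tau] on the full space, and with
    [tau] truncated at [s] on the space carrying [F s]. *)
Lemma measurable_stochastic_interval d (T : measurableType d) (R : realType)
    (tau : T -> \bar R) (G : set T) (t : R) (f : R * T -> R) :
  measurable_fun setT tau -> measurable G -> measurable_fun setT f ->
  measurable_fun setT (fun z : R * T =>
    if [&& t <= z.1, (z.1%:E <= tau z.2)%E & z.2 \in G] then f z else 0).
Proof.
move=> mtau mG mf; apply: measurable_fun_ifT => //.
apply: measurable_and.
  by apply: measurable_fun_ler => //; exact: measurable_fst.
apply: measurable_and.
  apply: measurable_fun_lee; last exact: (measurableT_comp mtau measurable_snd).
  by apply/measurable_EFinP; exact: measurable_fst.
apply: (measurable_fun_bool true).
rewrite setTI (_ : _ @^-1` _ = setT `*` G); first exact: measurableX.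
by apply/seteqP; split => [z /= /set_mem//|z /= [_ Gz]]; rewrite mem_set.
Qed.

(** * Restriction to a stochastic interval *)

Section cut.
Context d (T : measurableType d) (R : realType) (F : R -> set (set T)).
Hypotheses (Fs : forall t, sigma_algebra setT (F t))
  (Fm : forall t, F t `<=` measurable)
  (Fmono : forall s t, s <= t -> F s `<=` F t).
Context (tau : T -> \bar R) (a : R -> T -> R) (l : R).
Hypotheses (tauF : stopping_time F tau) (aF : progressive F a).
Hypotheses (a0 : forall (t : R) w, 0 <= t -> 0 <= a t w) (l0 : 0 <= l).

(* [a] restricted to the stochastic interval [[t, tau]] and to the event [G]; integrals
   over the random intervals of the theorem become integrals over the whole line. *)
Definition cut (G : set T) (t s : R) (w : T) : R :=
  if [&& t <= s, (s%:E <= tau w)%E & w \in G] then a s w else 0.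

Lemma cut_ge0 G (t s : R) w : 0 <= t -> 0 <= cut G t s w.
Proof.
by move=> t0; rewrite /cut; case: ifPn => // /andP[ts _]; rewrite a0// (le_trans t0).
Qed.

Lemma measurable_cut G (t : R) : 0 <= t -> measurable G ->
  measurable_fun setT (fun z : R * T => cut G t z.1 z.2).
Proof.
move=> t0 mG.
have mtau := stopping_time_measurable Fm tauF.
have := measurable_stochastic_interval t mtau mG
  (progressive_measurable_fun_pos Fs Fm aF).
congr (measurable_fun _ _); apply/funext => z; rewrite /cut.
by case: ifPn => // /andP[tz _]; rewrite (le_trans t0 tz).
Qed.

(** Up to time [s] the process depends only on [a] over [[0, s]], on [tau] truncated at [s], and on
    [G], which lies in [F s] because [t <= s]. *)
Lemma cut_adapted G (t s : R) : 0 <= t -> t <= s -> F t G ->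
  measurable_fun setT (fun w : g_sigma_algebraType (F s) => (cut G t s w)%:E *
    expeR (\int[lebesgue_measure]_(r in `]-oo, s]) (l * cut G t r w)%:E))%E.
Proof.
move=> t0 ts FG; pose TG := g_sigma_algebraType (F s).
have mG : measurable (G : set TG).
  by apply/(g_sigma_measurableE (Fs s)); exact: Fmono ts _ FG.
have mc := measurable_stochastic_interval t
  (stopping_time_measurable_min Fs Fmono tauF) mG
  (progressive_measurable_fun Fs aF (le_trans t0 ts)).
(* [c] agrees with the cut process up to [s] and vanishes after [s], so its integral over the whole
   line is the running integral at [s]. *)
set c := (fun z => _) in mc.
have cE r w : r <= s -> c (r, w) = cut G t r w.
  move=> rs; rewrite /c /cut/= le_min lee_fin rs andbT.
  case: ifPn => // /andP[tr _].
  by rewrite (le_trans t0 tr).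
have c0 r w : s < r -> c (r, w) = 0.
  by move=> sr; rewrite /c/= le_min lee_fin [r <= s]leNgt sr !andbF.
have cge0 z : 0 <= c z.
  case: z => r w; have [/cE ->|/c0 ->//] := leP r s; exact: cut_ge0.
apply: emeasurable_funM.
  apply/measurable_EFinP.
  have := measurable_fun_pair2 s mc.
  by congr (measurable_fun _ _); apply/funext => w; rewrite cE.
apply: measurableT_comp; first exact: measurable_expeR.
have mlc : measurable_fun setT (fun z : R * TG => (l * c z)%:E).
  by apply/measurable_EFinP; exact: measurable_funM.
have lc0 z : (0 <= (l * c z)%:E)%E by rewrite lee_fin mulr_ge0.
have := @measurable_fun_fubini_tonelli_G _ _ _ _ R lebesgue_measure _ mlc lc0.
congr (measurable_fun _ _); apply/funext => w.
rewrite [RHS]integral_mkcond; apply: eq_integral => r _.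
rewrite patchE mem_setE/= in_itv/=.
by case: leP => [/cE ->|/c0 ->]//; rewrite mulr0.
Qed.

(** If [tau w < t], the domain on the left is contained in the single point [tau w], which is
    Lebesgue null, and the cut process vanishes identically. *)
Lemma integral_min_tau (t : R) w (k : R -> \bar R) : 0 <= t ->
  (\int[lebesgue_measure]_(s in [set s : R | (Order.min t%:E (tau w) <= s%:E)%E /\
     (s%:E <= tau w)%E]) ((a s w)%:E * k s) =
   \int[lebesgue_measure]_s ((cut setT t s w)%:E * k s))%E.
Proof.
move=> t0; have [ttau|taut] := leP t%:E (tau w).
  rewrite [LHS]integral_mkcond; apply: eq_integral => s _.
  rewrite patchE /cut in_setT andbT.
  case: ifPn => [/set_mem/= [ts ->]|]; first by rewrite -lee_fin ts.
  move=> /negP h; rewrite ifN ?mul0e//; apply/negP => /andP[ts stau].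
  by apply: h; apply/mem_set; split; rewrite ?lee_fin.
rewrite [RHS](_ : _ = 0%E); last first.
  apply: integral0_eq => s _; rewrite /cut.
  case: ifPn => [/and3P[ts stau _]|_]; last by rewrite mul0e.
  have ts' : (t%:E <= s%:E)%E by rewrite lee_fin.
  by have := lt_le_trans taut (le_trans ts' stau); rewrite ltxx.
apply: (@integral_Sset1 _ _ _ (fine (tau w))) => s /= [h1 h2].
by have /eqP <- : s%:E == tau w by rewrite eq_le h1 h2.
Qed.

Lemma integral_0_tau w (k : R -> \bar R) :
  (\int[lebesgue_measure]_(s in [set s : R | (0 <= s)%R /\ (s%:E <= tau w)%E])
     ((a s w)%:E * k s) =
   \int[lebesgue_measure]_s ((cut setT 0 s w)%:E * k s))%E.
Proof.
rewrite [LHS]integral_mkcond; apply: eq_integral => s _.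
rewrite patchE /cut in_setT andbT.
case: ifPn => [/set_mem/= [-> ->]//|].
move=> /negP h; rewrite ifN ?mul0e//; apply/negP => /andP[ts stau].
by apply: h; apply/mem_set.
Qed.

End cut.

(** * The integrated conclusion on events of the filtration *)

Section gronwall.
Context d (T : measurableType d) (R : realType) (P : probability T R).
Context (F : R -> set (set T)).
Hypotheses (Fs : forall t, sigma_algebra setT (F t))
  (Fm : forall t, F t `<=` measurable)
  (Fmono : forall s t, s <= t -> F s `<=` F t).
Context (p q l theta : R) (tau : T -> \bar R) (xi : T -> R) (a x : R -> T -> R).
Hypotheses (p1 : 1 < p) (l0 : 0 <= l) (pq : p^-1 + q^-1 = 1) (theta0 : 0 <= theta).
Hypotheses (tauF : stopping_time F tau) (aF : progressive F a) (xF : progressive F x).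
Hypotheses (a0 : forall (t : R) w, 0 <= t -> 0 <= a t w)
  (x0 : forall (t : R) w, 0 <= t -> 0 <= x t w) (xi0 : forall w, 0 <= xi w).
Hypothesis (mxi : measurable_fun setT xi).

Local Notation c := (cut tau a).
(** [xx] is 0 at negative times, where nothing is known about [x]. [S] is [A(tau)], [cum s] is [A]
    at the minimum of [s] and [tau], [U] is the integral in the moment condition on [x], and [Z t]
    is the variable conditioned on [F t] in the hypothesis. *)
Let xx (s : R) w := if 0 <= s then x s w else 0.
Let S w := (\int[lebesgue_measure]_s (c setT 0 s w)%:E)%E.
Let cum s w := (\int[lebesgue_measure]_(r in `]-oo, s]) (c setT 0 r w)%:E)%E.
Let U w := (\int[lebesgue_measure]_s
  ((c setT 0 s w)%:E * (expeR ((theta / 2)%:E * cum s w) * (xx s w)%:E)))%E.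
Let Z t w := ((xi w)%:E +
  l%:E * \int[lebesgue_measure]_s ((c setT t s w)%:E * (xx s w)%:E))%E.

Hypothesis S_exp : (\int[P]_w expeR ((q / 2 * Num.max (2 * l - theta) 0)%:E * S w) < +oo)%E.
Hypothesis xi_exp : (\int[P]_w (expeR ((p / 2 * theta)%:E * S w) *
  poweR (`|xi w|)%:E p) < +oo)%E.
Hypothesis U_p : (\int[P]_w poweR (U w) p < +oo)%E.

Let q0 : 0 < q.
Proof.
rewrite -invr_gt0; have : p^-1 < 1 by rewrite invf_lt1// (lt_trans ltr01).
by move: pq; lra.
Qed.

Let c_ge0 G (t s : R) w : 0 <= t -> 0 <= c G t s w.
Proof. by move=> t0; exact: cut_ge0. Qed.

Let xx0 s w : 0 <= xx s w.
Proof. by rewrite /xx; case: ifPn => // /x0. Qed.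

Let mxx : measurable_fun setT (fun z : R * T => xx z.1 z.2).
Proof. exact: progressive_measurable_fun_pos. Qed.

Let mc G t : 0 <= t -> measurable G -> measurable_fun setT (fun z : R * T => c G t z.1 z.2).
Proof. by move=> t0 mG; exact: measurable_cut. Qed.

Let m_int (f : R * T -> \bar R) : measurable_fun setT f -> (forall z, 0 <= f z)%E ->
  measurable_fun setT (fun w : T => \int[lebesgue_measure]_s f (s, w))%E.
Proof.
move=> mf f0.
exact: (@measurable_fun_fubini_tonelli_G _ _ _ _ R lebesgue_measure f mf f0).
Qed.

Let mcum : measurable_fun setT (fun z : R * T => cum z.1 z.2).
Proof.
apply: (@measurable_integral_Nyc _ T R (fun r w => (c setT 0 r w)%:E)).
  by apply/measurable_EFinP; exact: mc.
by move=> s w; rewrite lee_fin c_ge0.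
Qed.

Let uf (z : R * T) := ((c setT 0 z.1 z.2)%:E *
  (expeR ((theta / 2)%:E * cum z.1 z.2) * (xx z.1 z.2)%:E))%E.

Let uf0 z : (0 <= uf z)%E.
Proof. by rewrite /uf !mule_ge0 ?lee_fin ?c_ge0// expeR_ge0. Qed.

Let muf : measurable_fun setT uf.
Proof.
apply: emeasurable_funM; first by apply/measurable_EFinP; exact: mc.
apply: emeasurable_funM; last exact/measurable_EFinP.
apply: measurableT_comp; first exact: measurable_expeR.
exact: measurable_funeM.
Qed.

Let mU : measurable_fun setT U. Proof. exact: m_int muf uf0. Qed.

Let U0 w : (0 <= U w)%E. Proof. by apply: integral_ge0 => s _; exact: (uf0 (s, w)). Qed.

Let mS : measurable_fun setT S.
Proof.
apply: (m_int (f := fun z => (c setT 0 z.1 z.2)%:E)).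
  by apply/measurable_EFinP; exact: mc.
by move=> z; rewrite lee_fin c_ge0.
Qed.

Let S0 w : (0 <= S w)%E. Proof. by apply: integral_ge0 => s _; rewrite lee_fin c_ge0. Qed.

Let cum0 s w : (0 <= cum s w)%E.
Proof. by apply: integral_ge0 => r _; rewrite lee_fin c_ge0. Qed.

Let cumS s w : (cum s w <= S w)%E.
Proof.
apply: ge0_subset_integral => //.
- by apply/measurable_EFinP; exact: (measurable_fun_pair1 w (mc (lexx 0) measurableT)).
- by move=> r _; rewrite lee_fin c_ge0.
Qed.

Let cut_cut0 G t s w : 0 <= t -> c G t s w != 0 -> c G t s w = c setT 0 s w.
Proof.
move=> t0; rewrite /cut in_setT andbT; case: ifPn => [/and3P[ts -> _] _|_]; last by rewrite eqxx.
by rewrite (le_trans t0 ts).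
Qed.

Let cut_le_cut0 G t s w : 0 <= t -> c G t s w <= c setT 0 s w.
Proof.
move=> t0; have [->|/cut_cut0 ->//] := eqVneq (c G t s w) 0; exact: c_ge0.
Qed.

(** Split [l <= m + theta / 2] with [m] half the positive part: the [m] share is bounded by the
    total [S], while the [theta / 2] share keeps the running integral, to match the weight inside
    [U]. *)
Lemma exponential_weight_bound G t s w : 0 <= t -> measurable G ->
  (expeR (\int[lebesgue_measure]_(r in `]-oo, s]) (l * c G t r w)%:E) <=
   expeR ((Num.max (2 * l - theta) 0 / 2)%:E * S w) *
   expeR ((theta / 2)%:E * cum s w))%E.
Proof.
move=> t0 mG; set m := Num.max (2 * l - theta) 0 / 2.
have m0 : 0 <= m by rewrite divr_ge0// le_max lexx orbT.
have lm : l <= m + theta / 2.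
  have : 2 * l - theta <= Num.max (2 * l - theta) 0 by rewrite le_max lexx.
  rewrite /m; lra.
have mcw H u : 0 <= u -> measurable H ->
    measurable_fun setT (fun r : R => c H u r w).
  by move=> u0 mH; exact: (measurable_fun_pair1 w (mc u0 mH)).
rewrite -expeRD lee_expeR.
apply: (@le_trans _ _ (l%:E * cum s w)%E).
  rewrite /cum -ge0_integralZl_EFin//.
  - apply: ge0_le_integral => //.
    + by move=> r _; rewrite lee_fin mulr_ge0// c_ge0.
    + apply: measurable_funTS; apply/measurable_EFinP; apply: measurable_funM => //.
      exact: mcw.
    + apply: measurable_funTS; apply: measurable_funeM.
      by apply/measurable_EFinP; exact: mcw.
    + by move=> r _; rewrite -EFinM lee_fin ler_wpM2l// cut_le_cut0.
  - by move=> r _; rewrite lee_fin c_ge0.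
  - by apply: measurable_funTS; apply/measurable_EFinP; exact: mcw.
apply: (@le_trans _ _ ((m + theta / 2)%:E * cum s w)%E).
  by rewrite lee_wpmul2r ?lee_fin.
rewrite EFinD ge0_muleDl ?lee_fin// ?divr_ge0//.
by rewrite leeD2r// lee_wpmul2l ?lee_fin.
Qed.

(** Pathwise the integral is at most [V * U]. Young's inequality leaves the moment of [U] of order
    [p] and that of [V] of order [q], and [V] to the power [q] is exactly the integrand of
    [S_exp]. *)
Lemma weighted_integral_lty G t : 0 <= t -> measurable G ->
  (\int[P]_w \int[lebesgue_measure]_s ((c G t s w)%:E *
     expeR (\int[lebesgue_measure]_(r in `]-oo, s]) (l * c G t r w)%:E) *
     (xx s w)%:E) < +oo)%E.
Proof.
move=> t0 mG; set m := Num.max (2 * l - theta) 0 / 2.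
pose V w := expeR (m%:E * S w).
have V0 w : (0 <= V w)%E by exact: expeR_ge0.
have mV : measurable_fun setT V.
  apply: measurableT_comp; first exact: measurable_expeR.
  exact: measurable_funeM.
have mpow (f : T -> \bar R) r : measurable_fun setT f ->
    measurable_fun setT (fun w => poweR (f w) r).
  by move=> mf; exact: (measurableT_comp (measurable_poweR r) mf).
have mE : measurable_fun setT (fun z : R * T =>
    expeR (\int[lebesgue_measure]_(r in `]-oo, z.1]) (l * c G t r z.2)%:E))%E.
  apply: measurableT_comp; first exact: measurable_expeR.
  apply: (@measurable_integral_Nyc _ T R (fun r w => (l * c G t r w)%:E)).
    by apply/measurable_EFinP; apply: measurable_funM => //; exact: mc.
  by move=> s w; rewrite lee_fin mulr_ge0// c_ge0.
have mf : measurable_fun setT (fun z : R * T => (c G t z.1 z.2)%:E *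
     expeR (\int[lebesgue_measure]_(r in `]-oo, z.1]) (l * c G t r z.2)%:E) *
     (xx z.1 z.2)%:E)%E.
  apply: emeasurable_funM; last exact/measurable_EFinP.
  by apply: emeasurable_funM => //; apply/measurable_EFinP; exact: mc.
have f0 s w : (0 <= (c G t s w)%:E *
     expeR (\int[lebesgue_measure]_(r in `]-oo, s]) (l * c G t r w)%:E) *
     (xx s w)%:E)%E.
  by rewrite !mule_ge0 ?lee_fin ?c_ge0// expeR_ge0.
have bound w : (\int[lebesgue_measure]_s ((c G t s w)%:E *
     expeR (\int[lebesgue_measure]_(r in `]-oo, s]) (l * c G t r w)%:E) *
     (xx s w)%:E) <= V w * U w)%E.
  rewrite /U -ge0_integralZl//.
  - apply: ge0_le_integral => //.
    + exact: (measurable_fun_pair1 w mf).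
    + by apply: measurable_funeM; exact: (measurable_fun_pair1 w muf).
    + move=> s _; have [->|cn0] := eqVneq (c G t s w) 0.
        by rewrite !mul0e mule_ge0//; exact: (uf0 (s, w)).
      rewrite (cut_cut0 t0 cn0) muleCA -muleA lee_wpmul2l ?lee_fin ?c_ge0//.
      rewrite muleA lee_wpmul2r ?lee_fin//.
      exact: exponential_weight_bound.
  - exact: (measurable_fun_pair1 w muf).
  - by move=> s _; exact: (uf0 (s, w)).
apply: (@le_lt_trans _ _ (\int[P]_w (poweR (U w) p + poweR (V w) q))%E).
  apply: ge0_le_integral => //.
  - by move=> w _; exact: integral_ge0.
  - by apply: (m_int mf) => -[s w]; exact: f0.
  - by apply: emeasurable_funD; exact: mpow.
  - move=> w _; apply: (le_trans (bound w)); rewrite muleC.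
    apply: mule_le_poweRD => //; exact: lt_trans p1.
rewrite ge0_integralD//.
- apply: lte_add_pinfty => //; apply: le_lt_trans S_exp.
  rewrite le_eqVlt; apply/orP; left; apply/eqP; apply: eq_integral => w _.
  rewrite poweR_expeR// muleA -EFinM; congr (expeR (_%:E * _)).
  by rewrite /m mulrA mulrAC.
- by move=> w _; exact: poweR_ge0.
- exact: mpow.
- by move=> w _; exact: poweR_ge0.
- exact: mpow.
Qed.

Let xi_int : (\int[P]_w (xi w)%:E < +oo)%E.
Proof.
have mpw : measurable_fun setT (fun w => poweR (`|xi w|)%:E p).
  apply: (measurableT_comp (measurable_poweR p)).
  by apply/measurable_EFinP; exact: measurableT_comp.
have mew : measurable_fun setT (fun w => expeR ((p / 2 * theta)%:E * S w)).
  apply: measurableT_comp; first exact: measurable_expeR.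
  exact: measurable_funeM.
apply: (@le_lt_trans _ _ (\int[P]_w (1 +
    expeR ((p / 2 * theta)%:E * S w) * poweR (`|xi w|)%:E p))%E).
  apply: ge0_le_integral => //.
  - by move=> w _; rewrite lee_fin.
  - exact/measurable_EFinP.
  - by apply: emeasurable_funD => //; exact: emeasurable_funM.
  - move=> w _; apply: (@le_trans _ _ (1 + poweR (`|xi w|)%:E p)%E).
      rewrite ger0_norm//; apply: le_1D_poweR; first exact: ltW.
      by rewrite lee_fin.
    rewrite leeD2l// -[leLHS]mul1e lee_wpmul2r ?poweR_ge0//.
    rewrite -expeR0 lee_expeR mule_ge0// lee_fin mulr_ge0// divr_ge0//.
    by rewrite ltW// (lt_trans ltr01).
rewrite ge0_integralD//.
- apply: lte_add_pinfty => //.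
  by rewrite integral_cst// mul1e (le_lt_trans (probability_le1 P measurableT))// ltry.
- by move=> w _; rewrite mule_ge0 ?expeR_ge0// poweR_ge0.
- exact: emeasurable_funM.
Qed.

Let mcx G t : 0 <= t -> measurable G ->
  measurable_fun setT (fun z : R * T => (c G t z.1 z.2)%:E * (xx z.1 z.2)%:E)%E.
Proof.
by move=> t0 mG; apply: emeasurable_funM; apply/measurable_EFinP => //; exact: mc.
Qed.

Let cx0 G t s w : 0 <= t -> (0 <= (c G t s w)%:E * (xx s w)%:E)%E.
Proof. by move=> t0; rewrite mule_ge0 ?lee_fin ?c_ge0. Qed.

Let mcxi G t : 0 <= t -> measurable G -> measurable_fun setT
  (fun w : T => \int[lebesgue_measure]_s ((c G t s w)%:E * (xx s w)%:E))%E.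
Proof. by move=> t0 mG; apply: (m_int (mcx t0 mG)) => -[s w]; exact: cx0. Qed.

Let cxi0 G t w : 0 <= t -> (0 <= \int[lebesgue_measure]_s ((c G t s w)%:E * (xx s w)%:E))%E.
Proof. by move=> t0; apply: integral_ge0 => s _; exact: cx0. Qed.

Let mZ t : 0 <= t -> measurable_fun setT (Z t).
Proof.
move=> t0; apply: emeasurable_funD; first exact/measurable_EFinP.
by apply: measurable_funeM; exact: mcxi.
Qed.

Let Z0 t w : 0 <= t -> (0 <= Z t w)%E.
Proof. by move=> t0; rewrite adde_ge0 ?lee_fin// mule_ge0 ?lee_fin// cxi0. Qed.

(** This is what [exists_condexp] requires of [Z t]. The weight in [U] is at least 1, so the time
    integral in [Z t] is at most [U], whose moment of order [p] is finite. *)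
Let Z_int t : 0 <= t -> (\int[P]_w Z t w < +oo)%E.
Proof.
move=> t0; rewrite ge0_integralD//.
- apply: lte_add_pinfty => //; rewrite ge0_integralZl_EFin//.
  + apply: lte_mul_pinfty => //.
    apply: (@le_lt_trans _ _ (\int[P]_w (1 + poweR (U w) p))%E).
      apply: ge0_le_integral => //.
      * by move=> w _; exact: cxi0.
      * exact: mcxi.
      * apply: emeasurable_funD => //.
        exact: (measurableT_comp (measurable_poweR p) mU).
      * move=> w _; apply: (@le_trans _ _ (U w)).
          apply: ge0_le_integral => //.
          -- by move=> s _; exact: cx0.
          -- exact: (measurable_fun_pair1 w (mcx t0 measurableT)).
          -- exact: (measurable_fun_pair1 w muf).
          -- move=> s _; apply: lee_pmul; rewrite ?lee_fin ?c_ge0 ?cut_le_cut0//.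
             rewrite -[leLHS]mul1e lee_wpmul2r ?lee_fin//.
             by rewrite -expeR0 lee_expeR mule_ge0// lee_fin divr_ge0.
        by apply: le_1D_poweR => //; exact: ltW.
    rewrite ge0_integralD//.
    * apply: lte_add_pinfty => //.
      by rewrite integral_cst// mul1e (le_lt_trans (probability_le1 P measurableT))// ltry.
    * by move=> w _; exact: poweR_ge0.
    * exact: (measurableT_comp (measurable_poweR p) mU).
  + by move=> w _; exact: cxi0.
  + exact: mcxi.
- by move=> w _; rewrite lee_fin.
- exact/measurable_EFinP.
- by move=> w _; rewrite mule_ge0 ?lee_fin// cxi0.
- by apply: measurable_funeM; exact: mcxi.
Qed.

Hypothesis x_le : forall t, 0 <= t -> forall Y : T -> \bar R,
  is_condexp P (F t) (Z t) Y -> {ae P, forall w, ((x t w)%:E <= Y w)%E}.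

Let mx t : 0 <= t -> measurable_fun setT (x t).
Proof.
move=> t0; have := measurable_fun_pair2 t mxx.
by congr (measurable_fun _ _); apply/funext => w; rewrite /xx/= t0.
Qed.

(** On an event of [F t] a version of the conditional expectation has the same integral as [Z t], so
    the almost sure bound can be integrated. *)
Let integral_x_le t H : 0 <= t -> F t H ->
  (\int[P]_(w in H) (x t w)%:E <= \int[P]_(w in H) Z t w)%E.
Proof.
move=> t0 FH; have mH := Fm FH.
have [Y YZ] := exists_condexp (Fs t) (@Fm t) (mZ t0) (fun w => Z0 w t0) (Z_int t0).
have xY := x_le t0 YZ; have [mY Y0 <- //] := YZ.
apply: ae_ge0_le_integral => //.
- by move=> w _; rewrite lee_fin x0.
- by apply: measurable_funTS; apply/measurable_EFinP; exact: mx.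
- apply: measurable_funTS; apply: (g_sigma_measurable_fun (Fs t) (@Fm t)).
  exact/(meas_wrtEP (Fs t)).
- by apply: filterS xY => w ? _.
Qed.

Let weight G t s w := ((c G t s w)%:E *
  expeR (\int[lebesgue_measure]_(r in `]-oo, s]) (l * c G t r w)%:E))%E.

Let weighted_x_le G t s : 0 <= t -> F t G ->
  (\int[P]_w (weight G t s w * (xx s w)%:E) <=
   \int[P]_w (weight G t s w * ((xi w)%:E +
    l%:E * \int[lebesgue_measure]_(r in `[s, +oo[) ((c G t r w)%:E * (xx r w)%:E))))%E.
Proof.
move=> t0 FG; set h := weight G t s.
have h0 w : (0 <= h w)%E by rewrite mule_ge0 ?lee_fin ?c_ge0// expeR_ge0.
have [st|ts] := ltP s t.
  have hE w : h w = 0%E by rewrite /h /weight /cut leNgt st/= mul0e.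
  under eq_integral do rewrite hE mul0e.
  by under [leRHS]eq_integral do rewrite hE mul0e.
have s0 := le_trans t0 ts.
have mhG := cut_adapted Fs Fmono tauF aF a0 l0 t0 ts FG.
have mh : measurable_fun setT h := g_sigma_measurable_fun (Fs s) (@Fm s) mhG.
have : (\int[P]_w (h w * (x s w)%:E) <= \int[P]_w (h w * Z s w))%E.
  apply: le_integral_weight => //.
  - by apply/measurable_EFinP; exact: mx.
  - exact: mZ.
  - by move=> w; rewrite lee_fin x0.
  - by move=> w; exact: Z0.
  (* The level sets of the weight lie in [F s] by [cut_adapted]. *)
  - move=> u; apply: integral_x_le => //; apply/(g_sigma_measurableE (Fs s)).
    by have := emeasurable_fun_o_infty measurableT mhG u%:E; rewrite setTI.
rewrite (eq_integral (fun w => h w * (xx s w)%:E)%E); last first.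
  by move=> w _; rewrite /xx s0.
(* Off [G] the weight is 0. On [G], since [t <= s], restarting the cut at [s] is the same as
   integrating the cut from [t] over [[s, +oo[]. *)
move=> /le_trans; apply; rewrite le_eqVlt; apply/orP; left; apply/eqP.
apply: eq_integral => w _.
have [wG|wG] := boolP (w \in G); last first.
  by rewrite /h /weight /cut (negbTE wG) !andbF !mul0e.
congr (_ * (_ + _ * _))%E; rewrite [RHS]integral_mkcond; apply: eq_integral => r _.
rewrite patchE mem_setE/= in_itv/= andbT /cut in_setT wG.
by case: (leP s r) => [sr|rs]; rewrite ?mul0e// (le_trans ts sr).
Qed.

Lemma gronwall_integral_le G t : 0 <= t -> F t G ->
  (\int[P]_(w in G) (x t w)%:E <= \int[P]_(w in G) ((xi w)%:E *
     expeR (l%:E * \int[lebesgue_measure]_s (c setT t s w)%:E)))%E.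
Proof.
move=> t0 FG; have mG := Fm FG.
have main := weighted_gronwall (P := P) l0 (mc t0 mG) mxx mxi
  (fun s w => c_ge0 G s w t0) xx0 xi0 (fun s => weighted_x_le s t0 FG)
  (weighted_integral_lty t0 mG).
pose E s w := expeR (\int[lebesgue_measure]_(r in `]-oo, s]) (l * c G t r w)%:E)%E.
pose K w := (\int[lebesgue_measure]_s ((c G t s w)%:E * E s w))%E.
have cK0 s w : (0 <= (c G t s w)%:E * E s w)%E.
  by rewrite mule_ge0 ?lee_fin ?c_ge0// expeR_ge0.
have K0 w : (0 <= K w)%E by exact: integral_ge0.
have mE : measurable_fun setT (fun z : R * T => E z.1 z.2).
  apply: measurableT_comp; first exact: measurable_expeR.
  apply: (@measurable_integral_Nyc _ T R (fun r w => (l * c G t r w)%:E)).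
    by apply/measurable_EFinP; apply: measurable_funM => //; exact: mc.
  by move=> s w; rewrite lee_fin mulr_ge0// c_ge0.
have mcE : measurable_fun setT (fun z : R * T => (c G t z.1 z.2)%:E * E z.1 z.2)%E.
  by apply: emeasurable_funM => //; apply/measurable_EFinP; exact: mc.
have mK : measurable_fun setT K by apply: (m_int mcE) => -[s w]; exact: cK0.
have mxiE : measurable_fun setT (fun w => (xi w)%:E) by exact/measurable_EFinP.
have notG w s : w \notin G -> c G t s w = 0 by move=> /negbTE wG; rewrite /cut wG !andbF.
have inG w s : w \in G -> c G t s w = c setT t s w by move=> wG; rewrite /cut wG in_setT.
apply: (le_trans (integral_x_le t0 FG)).
apply: (@le_trans _ _ (\int[P]_(w in G) ((xi w)%:E + l%:E * ((xi w)%:E * K w)))%E).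
  rewrite !ge0_integralD//.
  - rewrite leeD2l// !ge0_integralZl_EFin//.
    + rewrite lee_wpmul2l ?lee_fin//.
      (* [main] integrates over the whole sample space, but both of its integrands vanish off
         [G]. *)
      rewrite [leLHS]integral_mkcond [leRHS]integral_mkcond.
      move: main; congr (_ <= _)%E; apply: eq_integral => w _; rewrite patchE.
        case: ifPn => wG; first by apply: eq_integral => s _; rewrite inG.
        by apply: integral0_eq => s _; rewrite notG// mul0e.
      case: ifPn => // wG.
      by rewrite integral0_eq ?mule0// => s _; rewrite notG// mul0e.
    + by move=> w _; rewrite mule_ge0 ?lee_fin.
    + by apply: measurable_funTS; exact: emeasurable_funM.
    + by move=> w _; exact: cxi0.
    + by apply: measurable_funTS; exact: mcxi.
  - by move=> w _; rewrite lee_fin.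
  - exact: measurable_funTS.
  - by move=> w _; rewrite !mule_ge0 ?lee_fin.
  - by apply: measurable_funTS; apply: measurable_funeM; exact: emeasurable_funM.
  - by move=> w _; rewrite lee_fin.
  - exact: measurable_funTS.
  - by move=> w _; rewrite mule_ge0 ?lee_fin// cxi0.
  - by apply: measurable_funTS; apply: measurable_funeM; exact: mcxi.
have mcT : measurable_fun setT (fun z : R * T => (c setT t z.1 z.2)%:E).
  by apply/measurable_EFinP; exact: mc.
apply: ge0_le_integral => //.
- by move=> w _; rewrite adde_ge0 ?mule_ge0 ?lee_fin// mule_ge0 ?lee_fin.
- apply: measurable_funTS; apply: emeasurable_funD => //.
  by apply: measurable_funeM; exact: emeasurable_funM.
- apply: measurable_funTS; apply: emeasurable_funM => //.
  apply: measurableT_comp; first exact: measurable_expeR.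
  apply: measurable_funeM; apply: (m_int mcT) => z.
  by rewrite lee_fin c_ge0.
- move=> w Gw; have wG : w \in G by exact/mem_set.
  have mcw : measurable_fun setT (fun s : R => c G t s w).
    exact: (measurable_fun_pair1 w (mc t0 mG)).
  rewrite -{1}[(xi w)%:E]mule1 muleCA -ge0_muleDr ?mule_ge0 ?lee_fin//.
  rewrite lee_wpmul2l ?lee_fin//.
  have lK : (l%:E * K w = \int[lebesgue_measure]_s ((l * c G t s w)%:E * E s w))%E.
    rewrite -ge0_integralZl_EFin//.
    + by apply: eq_integral => s _; rewrite muleA.
    + exact: (measurable_fun_pair1 w mcE).
  have lc : (l%:E * \int[lebesgue_measure]_s (c setT t s w)%:E =
      \int[lebesgue_measure]_s (l * c G t s w)%:E)%E.
    rewrite -ge0_integralZl_EFin//.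
    + by apply: eq_integral => s _; rewrite inG// EFinM.
    + by move=> s _; rewrite lee_fin c_ge0.
    + exact: (measurable_fun_pair1 w mcT).
  rewrite lK lc; apply: exp_integral_le; first exact: measurable_funM.
  by move=> s; rewrite mulr_ge0// c_ge0.
Qed.

End gronwall.

(** * Translation to the integrals of the theorem *)

Unset Implicit Arguments. Set Strict Implicit. Set Printing Implicit Defensive.

Theorem theorem1 (d : measure_display) (T : measurableType d) (R : realType)
  (P : probability T R) (dim : nat) (B : 'I_dim -> R -> T -> R)
  (p q l theta eps : R) (tau : T -> \bar R) (xi : T -> R) (a x : R -> T -> R) :
  complete_prob P -> brownian P B ->
  1 < p -> 0 <= l -> p^-1 + q^-1 = 1 ->
  let F := brownian_filtration P B in
  stopping_time F tau ->
  (forall w, 0 <= xi w) ->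
  progressive F a -> progressive F x ->
  (forall t w, 0 <= t -> 0 <= a t w) -> (forall t w, 0 <= t -> 0 <= x t w) ->
  0 < eps -> (forall t w, 0 <= t -> eps < a t w) ->
  let A := fun (t : R) (w : T) =>
    (\int[lebesgue_measure]_(s in [set s : R | (0 <= s <= t)%R]) (a s w)%:E)%E in
  let Atau := fun w =>
    (\int[lebesgue_measure]_(s in [set s : R | (0 <= s)%R /\ (s%:E <= tau w)%E]) (a s w)%:E)%E in
  0 <= theta ->
  (\int[P]_w expeR ((q / 2 * Num.max (2 * l - theta) 0)%:E * Atau w) < +oo)%E ->
  meas_wrt (stopped_sigma F tau) xi ->
  (\int[P]_w (expeR ((p / 2 * theta)%:E * Atau w) * poweR (`|xi w|)%:E p) < +oo)%E ->
  cadlag x -> adapted F x ->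
  (\int[P]_w poweR
      (\int[lebesgue_measure]_(s in [set s : R | (0 <= s)%R /\ (s%:E <= tau w)%E])
          ((a s w)%:E * expeR ((theta / 2)%:E * A s w) * (`|x s w|)%:E)) p < +oo)%E ->
  (forall t, 0 <= t -> forall Y : T -> \bar R,
     is_condexp P (F t)
       (fun w => ((xi w)%:E + l%:E *
          \int[lebesgue_measure]_(s in [set s : R | (Order.min t%:E (tau w) <= s%:E)%E /\
                                                    (s%:E <= tau w)%E])
             ((a s w)%:E * (x s w)%:E))%E) Y ->
     {ae P, forall w, ((x t w)%:E <= Y w)%E}) ->
  forall t, 0 <= t -> forall Y : T -> \bar R,
    is_condexp P (F t)
      (fun w => ((xi w)%:E * expeR (l%:E *
          \int[lebesgue_measure]_(s in [set s : R | (Order.min t%:E (tau w) <= s%:E)%E /\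
                                                    (s%:E <= tau w)%E])
             (a s w)%:E))%E) Y ->
    {ae P, forall w, ((x t w)%:E <= Y w)%E}.
Proof.
move=> _ [mB _ _ _] p1 l0 pq F tauF xi0 aF xF a0 x0 _ _ A Atau theta0
  S_exp mxiF xi_exp _ adx U_p x_le t t0 Y YZ.
have Fs s : sigma_algebra setT (F s) by exact: brownian_filtration_sigma_algebra.
have Fm s : F s `<=` measurable by exact: brownian_filtration_measurable.
have Fmono s u : s <= u -> F s `<=` F u by exact: brownian_filtration_mono.
clearbody F.
have mxi : measurable_fun setT xi.
  by move=> _ S mS; rewrite setTI; exact: stopped_sigma_measurable Fm _ _ (mxiF S mS).
(* [integral_0_tau] carries a factor [k]; the constant 1 gives the plain integral. *)
have AtauE w : Atau w = (\int[lebesgue_measure]_s (cut tau a setT 0 s w)%:E)%E.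
  have := integral_0_tau tau a w (fun=> 1%E).
  by under eq_integral do rewrite mule1; under [RHS]eq_integral do rewrite mule1.
have UE w : (\int[lebesgue_measure]_(s in [set s : R | (0 <= s)%R /\ (s%:E <= tau w)%E])
      ((a s w)%:E * expeR ((theta / 2)%:E * A s w) * (`|x s w|)%:E) =
    \int[lebesgue_measure]_s ((cut tau a setT 0 s w)%:E *
      (expeR ((theta / 2)%:E *
         \int[lebesgue_measure]_(r in `]-oo, s]) (cut tau a setT 0 r w)%:E) *
       (if 0 <= s then x s w else 0)%:E)))%E.
  under eq_integral do rewrite -muleA.
  rewrite integral_0_tau; apply: eq_integral => s _.
  have [->|] := eqVneq (cut tau a setT 0 s w) 0; first by rewrite !mul0e.
  rewrite {1}/cut; case: ifPn => [/and3P[s0 stau _] _|_]; last by rewrite eqxx.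
  (* For [0 <= s <= tau w], every time [r <= s] also precedes [tau w], so [A s] equals the running
     integral of the cut process. *)
  rewrite s0 ger0_norm ?x0//; congr (_ * (expeR (_ * _) * _))%E.
  rewrite /A integral_mkcond [RHS]integral_mkcond; apply: eq_integral => r _.
  have memE : (r \in [set u : R | 0 <= u <= s]) = (0 <= r <= s).
    by apply/idP/idP => [/set_mem|rs]//; exact/mem_set.
  rewrite !patchE memE mem_setE in_itv/= /cut in_setT andbT.
  have [rs|rs] := leP r s; last by rewrite andbF.
  by rewrite andbT (le_trans _ stau) ?lee_fin// andbT; case: ifP.
have ZE s w : 0 <= s ->
    ((xi w)%:E + l%:E * \int[lebesgue_measure]_(r in [set r : R |
      (Order.min s%:E (tau w) <= r%:E)%E /\ (r%:E <= tau w)%E]) ((a r w)%:E * (x r w)%:E) =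
     (xi w)%:E + l%:E * \int[lebesgue_measure]_r ((cut tau a setT s r w)%:E *
       (if 0 <= r then x r w else 0)%:E))%E.
  move=> s0; congr (_ + _ * _)%E; rewrite integral_min_tau//; apply: eq_integral => r _.
  rewrite /cut; case: ifPn => [/andP[sr _]|_]; last by rewrite !mul0e.
  by rewrite (le_trans s0 sr).
have intE w : (\int[lebesgue_measure]_(r in [set r : R |
      (Order.min t%:E (tau w) <= r%:E)%E /\ (r%:E <= tau w)%E]) (a r w)%:E =
    \int[lebesgue_measure]_r (cut tau a setT t r w)%:E)%E.
  have := integral_min_tau tau a w (fun=> 1%E) t0.
  by under eq_integral do rewrite mule1; under [RHS]eq_integral do rewrite mule1.
clearbody A Atau.
have [mY Y0 YE] := YZ.
(* Only events of [F t] have to be compared, and on them [Y] may be replaced by the variable it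
   conditions. *)
apply: (ae_le_of_integral_le (Fs t) (Fm t)) => //; first exact: adx.
- by move=> w; exact: x0.
- move=> H FH; rewrite YE//; under [leRHS]eq_integral do rewrite intE.
  apply: (gronwall_integral_le Fs Fm Fmono p1 l0 pq theta0 tauF aF xF a0 x0 xi0
    mxi _ _ _ _ t0 FH).
  + by under eq_integral do rewrite -AtauE.
  + by under eq_integral do rewrite -AtauE.
  + by under eq_integral do rewrite -UE.
  + move=> s s0 V VZ; apply: (x_le s s0).
    by under eq_fun do rewrite ZE//.
Qed.
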